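(* Let $\mathcal G\subseteq\mathcal F$ be a sub-$\sigma$-algebra and let $f$ be a convex normal integrand on $\mathbb{R}^n\times\Omega$ such that $\operatorname{dom}Ef\cap L^\infty(\mathcal G)\neq\emptyset$ and $\operatorname{dom}Ef^*\cap L^1(\mathcal F)\ne\emptyset$. For $x^*\in L^1(\mathcal G)$ define $\tilde\phi_{x^*}:L^\infty(\mathcal F)\to[-\infty,\infty]$ by $$\tilde\phi_{x^*}(z)=\inf_{x\in L^\infty(\mathcal G)}E[f(x+z)-(x+z)\cdot x^*].$$ (i) If $x^*\in L^1(\mathcal G)$ is such that $\tilde\phi_{x^*}$ is subdifferentiable at the origin, then there is a $v\in L^1(\mathcal F)$ such that $E^{\mathcal G}v=0$ and $$(E^{\mathcal G}f)^*(x^* )=E^{\mathcal G}[f^*(x^*+v)]\quad P\text{-a.s.}$$ (ii) If $x\in\operatorname{dom}Ef\cap L^0(\mathcal G)$ and $\tilde\phi_{x^*}$ is subdifferentiable at the origin for every $x^*\in L^1(\mathcal G;\partial E^{\mathcal G}f(x))$, then $$\partial[E^{\mathcal G}f](x)=E^{\mathcal G}\partial f(x)\quad P\text{-a.s.},$$ where the equality is understood whenever its right-hand side is defined, i.e. when $\omega\mapsto\partial f(x(\omega),\omega)$ admits an integrable selection.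
   Context: $(\Omega,\mathcal F,P)$ is a probability space; for a sub-$\sigma$-algebra $\mathcal H$, $L^p(\mathcal H):=L^p(\Omega,\mathcal H,P;\mathbb{R}^n)$. A normal integrand is a function $f:\mathbb{R}^n\times\Omega\to[-\infty,\infty]$ such that $\omega\mapsto\{(\xi,\alpha)\mid f(\xi,\omega)\le\alpha\}$ is a closed-valued $\mathcal F$-measurable set-valued mapping ($\mathcal G$-measurable normal integrand: same with $\mathcal G$); it is convex if $f(\cdot,\omega)$ is convex for every $\omega$. $Ef(x)$ is the expectation of $f(x):\omega\mapsto f(x(\omega),\omega)$, where the expectation of a measurable function is defined as $+\infty$ unless its positive part is integrable; $\operatorname{dom}Ef=\{x\mid Ef(x)<\infty\}$, and similarly for the pointwise conjugate $f^*$, $f^*(\cdot,\omega)=(f(\cdot,\omega))^*$. $E^{\mathcal G}$ applied to a random variable is the $\mathcal G$-conditional expectation. The $\mathcal G$-conditional expectation of the normal integrand $f$ is a $\mathcal G$-measurable normal integrand $E^{\mathcal G}f$ such that $(E^{\mathcal G}f)(x(\omega),\omega)=E^{\mathcal G}[f(x(\cdot),\cdot)](\omega)$ $P$-a.s. for all $x\in L^0(\mathcal G)$ such that either $f(x)^+\in L^1$ or $f(x)^-\in L^1$; when $\operatorname{dom}Ef^*\cap L^1(\mathcal F)\neq\emptyset$ it is known to exist and be unique up to a null set of $\omega$. $(E^{\mathcal G}f)^*$ is its pointwise conjugate. The $\mathcal G$-conditional expectation of an $\mathcal F$-measurable set-valued mapping $S:\Omega\rightrightarrows\mathbb{R}^n$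 is a $\mathcal G$-measurable closed-valued mapping $E^{\mathcal G}S$ such that $L^1(\mathcal G,E^{\mathcal G}S)=\operatorname{cl}\{E^{\mathcal G}v\mid v\in L^1(\mathcal F,S)\}$ (closure in $L^1$), where $L^1(\mathcal H,S)=L^1(\mathcal H;S)$ denotes the set of $v\in L^1(\mathcal H)$ with $v(\omega)\in S(\omega)$ a.s.; it is known to be well-defined and unique when $S$ admits at least one integrable selection, i.e. $L^1(\mathcal F,S)\ne\emptyset$. $\partial f(x)$ denotes the mapping $\omega\mapsto\partial f(x(\omega),\omega)$ (convex subdifferential of $f(\cdot,\omega)$ at $x(\omega)$), and similarly $\partial[E^{\mathcal G}f](x)$, $\partial E^{\mathcal G}f(x)$ is the mapping $\omega\mapsto\partial(E^{\mathcal G}f)(x(\omega),\omega)$. Subdifferentials are empty at points where the function is not finite. A function $g:L^\infty(\mathcal F)\to[-\infty,\infty]$ is subdifferentiable at the origin if $g(0)$ is finite and there is $v\in L^1(\mathcal F)$ with $g(z)\ge g(0)+E(z\cdot v)$ for all $z\in L^\infty(\mathcal F)$. *)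

(* Defs.v *)
From HB Require Import structures.
From mathcomp Require Import all_boot all_order all_algebra.
From mathcomp Require Import all_classical all_reals all_analysis.
From mathcomp Require Import measurable_realfun.

Set Implicit Arguments.
Unset Strict Implicit.
Unset Printing Implicit Defensive.

Import Order.TTheory GRing.Theory Num.Theory.
Import numFieldNormedType.Exports.

Local Open Scope classical_set_scope.
Local Open Scope ring_scope.

(* A sub-sigma-algebra of the ambient one is a set system [H : set_system T];
   the ambient sigma-algebra itself is [@measurable d T].  Elements of the
   spaces L^p are represented by functions that are measurable everywhere, not
   by classes modulo P. *)

Section ConvexFunctions.
Variables (R : realType) (n : nat).
Implicit Types (phi : 'rV[R]_n -> \bar R) (x v : 'rV[R]_n).

Definition dot x v : R := \sum_(j < n) x 0 j * v 0 j.

(* [R^o] is [R] seen as a vector space over itself, with the same topology. *)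
Definition epigraph phi : set ('rV[R]_n * R^o) :=
  [set p | (phi p.1 <= p.2%:E)%E].

(* For functions that may take both values -oo and +oo, convexity is convexity
   of the epigraph. *)
Definition econvex phi : Prop := convex_set (epigraph phi).

Definition conjugate phi v : \bar R :=
  ereal_sup [set (dot x v)%:E - phi x | x in [set: 'rV[R]_n]]%E.

Definition subdiff phi x : set 'rV[R]_n :=
  [set v | phi x \is a fin_num /\
           forall y : 'rV[R]_n, (phi x + (dot v (y - x))%:E <= phi y)%E].

End ConvexFunctions.

Definition is_sub_sigma_algebra d (T : measurableType d) (G : set_system T) :=
  sigma_algebra setT G /\ G `<=` @measurable d T.

Definition sub_measurable (T : Type) d' (U : measurableType d')
    (H : set_system T) (X : T -> U) : Prop :=
  forall B, measurable B -> H (X @^-1` B).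

Definition set_measurable (T : Type) (U : topologicalType)
    (H : set_system T) (S : T -> set U) : Prop :=
  forall O : set U, open O -> H [set w | S w `&` O !=set0].

Definition normal_integrand (R : realType) (n : nat) (T : Type)
    (H : set_system T) (f : 'rV[R]_n -> T -> \bar R) : Prop :=
  (forall w, closed (epigraph (f^~ w))) /\
  set_measurable H (fun w => epigraph (f^~ w)).

Section Integrals.
Context d (T : measurableType d) (R : realType) (P : probability T R).
Variable n : nat.
Implicit Types (H G : set_system T) (X Y : T -> \bar R) (x v u : T -> 'rV[R]_n).
Implicit Types (f h : 'rV[R]_n -> T -> \bar R) (S C : T -> set 'rV[R]_n).

(* The Borel sigma-algebra of R^n is the product one. *)
Definition L0 H : set (T -> 'rV[R]_n) :=
  [set x : T -> 'rV[R]_n | forall j, sub_measurable H (fun w => x w 0 j)].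

(* [`|x w|] is the sup norm of R^n. *)
Definition Lp H (p : \bar R) : set (T -> 'rV[R]_n) :=
  [set x | L0 H x /\ finite_norm P p (fun w => `|x w|)].

Definition Lp_sel H (p : \bar R) S : set (T -> 'rV[R]_n) :=
  [set v | Lp H p v /\ {ae P, forall w, S w (v w)}].

Definition Eext X : \bar R :=
  if `[< P.-integrable setT X^\+%E >] then (\int[P]_w X w)%E else +oo%E.

Definition Eint f x : \bar R := Eext (fun w => f (x w) w).

Definition quasi_integrable X : Prop :=
  P.-integrable setT X^\+%E \/ P.-integrable setT X^\-%E.

(* [Y] is a version of the [G]-conditional expectation of [X], which is defined
   for quasi-integrable extended-real random variables. *)
Definition is_condexp G X Y : Prop :=
  [/\ measurable_fun setT X, quasi_integrable X, sub_measurable G Y &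
      forall A, G A -> (\int[P]_(w in A) X w = \int[P]_(w in A) Y w)%E].

Definition is_condexp_vec G v u : Prop :=
  forall j, is_condexp G (fun w => (v w 0 j)%:E) (fun w => (u w 0 j)%:E).

Definition is_condexp_integrand G f h : Prop :=
  normal_integrand G h /\
  forall x, L0 G x -> quasi_integrable (fun w => f (x w) w) ->
    is_condexp G (fun w => f (x w) w) (fun w => h (x w) w).

(* As conditional expectations of integrable functions are in L^1(G), which is
   closed in L^1, the closure may be taken in L^1(G). *)
Definition L1_closure G (A : set (T -> 'rV[R]_n)) : set (T -> 'rV[R]_n) :=
  [set v | Lp G 1%E v /\ forall e : R, 0 < e ->
     exists2 u, A u & ('N[P]_1[(fun w => `|v w - u w|%:E)] < e%:E)%E].

Definition is_condexp_set G S C : Prop :=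
  [/\ forall w, closed (C w), set_measurable G C &
      Lp_sel G 1%E C =
      L1_closure G [set u | exists2 v, Lp_sel (@measurable d T) 1%E S v
                                     & is_condexp_vec G v u]].

Definition subdifferentiable0 (g : (T -> 'rV[R]_n) -> \bar R) : Prop :=
  g (cst 0) \is a fin_num /\
  exists2 v, Lp (@measurable d T) 1%E v &
    forall z, Lp (@measurable d T) +oo%E z ->
      (g (cst 0%R) + 'E_P[(fun w => dot (z w) (v w))] <= g z)%E.

Definition tilde_phi G f (xs : T -> 'rV[R]_n) (z : T -> 'rV[R]_n) : \bar R :=
  ereal_inf [set Eext (fun w => f (x w + z w)%R w -
                                 (dot (x w + z w) (xs w))%:E)%E
            | x in Lp G +oo%E].

End Integrals.

(* Main.v *)
(** Let [h] be the conditional expectation of [f], let [v] be a subgradient at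
    the origin of the value function phi of [xs], and put [u := xs + v].  Testing
    the subgradient inequality on L^oo(G) gives E^G v = 0; testing it on
    L^oo(F) and minimizing pointwise over y (measurable selection) gives
    E[f^*(u)] <= - phi(0).  Conversely, Fenchel's inequality
    f(y) >= y.u - f^*(u), conditioned on G and applied to measurable selections
    y of the epigraph of [h], gives h^*(xs) <= E^G[f^*(u)], and near minimizers
    of phi(0) give E[h^*(xs)] >= - phi(0), so that the two sides coincide
    almost surely.

    For the second part, a limit of conditional expectations of selections of
    the subdifferential of f at x is a selection of that of h, by conditioning
    the subgradient inequality.  If xs is a selection of the subdifferential of
    h at x, then f(x) + f^*(u) - x.u is nonnegative and has zero integral over
    each set {|x| <= N} by the first part, so u = xs + v is a selection of the
    subdifferential of f at x with E^G u = xs.  Finally, closed-valued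
    measurable mappings with the same nonempty set of integrable selections
    agree almost surely. *)
Require Import Defs.
From HB Require Import structures.
From mathcomp Require Import all_boot all_order all_algebra.
From mathcomp Require Import all_classical all_reals all_analysis.
From mathcomp Require Import measurable_realfun.
From mathcomp Require Import ess_sup_inf ring lra.
Import Order.TTheory GRing.Theory Num.Theory.
Import numFieldNormedType.Exports.
Local Open Scope classical_set_scope.
Local Open Scope ring_scope.

Set Implicit Arguments.
Unset Strict Implicit.
Unset Printing Implicit Defensive.

(** * Measurable selections *)

(** Two obstacles shape the proof. The first is measurability: selections are taken both for the
    ambient sigma-algebra and for [G], neither of them complete, so projection arguments are
    avoided. Sets to be measured or selected from are brought to the form: some point p of a
    closed-valued mapping has g(w, p) > 0, with g continuous in p and measurable in w. Such sets
    reduce to countably many tests on balls around dense points, and the same reduction produces a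
    selection. The second is integrability: integrands take infinite values and x is merely in L^0.
    A point of dom Ef^* controls the negative part of f(y) for bounded y, by Fenchel's inequality. A
    point of dom Ef is the fallback value of a test function wherever no suitable bounded selection
    exists, which keeps f(y) integrable. What remains unbounded is cut down to sets of [G] on which
    all quantities involved are bounded. *)

Section Selection.
Context d (T : measurableType d) (R : realType) (U : normedModType R).
Variable q : nat -> U.
Hypothesis q_dense : forall p (e : R), 0 < e -> exists k, `|p - q k| < e.
Hypothesis U_complete : forall F : set_system U, ProperFilter F -> cauchy F -> cvg F.

Definition nat_measurable (N : T -> nat) :=
  forall i, measurable (N @^-1` [set i]).

(** After the sets are made disjoint each point has at most one index, which makes the choice
    measurable. *)
Lemma first_index (A : nat -> set T) : (forall i, measurable (A i)) ->
  exists2 N, nat_measurable N & forall w i, A i w -> A (N w) w.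
Proof.
move=> mA; pose B := seqDU A.
have mB i : measurable (B i) by exact: seqDU_measurable.
exists (fun w => xget 0%N [set i | B i w]).
  move=> i.
  (* The default value of [xget] sends the points outside every [A k] to index 0, whose fibre is
     enlarged accordingly. *)
  rewrite (_ : _ @^-1` _ =
      B i `|` (if i == 0%N then ~` \bigcup_k A k else set0)).
    apply: measurableU => //; case: ifP => // _; apply: measurableC.
    exact: bigcupT_measurable.
  rewrite seqDU_bigcup_eq; apply/seteqP; split=> w /=.
    have [[j Bj] <-|noB] := pselect (exists j, B j w).
      by left; apply: (@xgetI _ _ [set i | B i w] j).
    rewrite xgetPN => [<-|j Bj]; last by apply: noB; exists j.
    by right => -[j _ Bj]; apply: noB; exists j.
  case=> [Bi|].
    have Bx : B (xget 0%N [set i | B i w]) w.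
      exact: (@xgetI _ _ [set i | B i w] i).
    by apply: (@trivIset_seqDU _ A _ i) => //; exists w.
  by case: eqP => // -> noB; rewrite xgetPN// => j Bj; apply: noB; exists j.
move=> w i Ai.
have : (\bigcup_k B k) w by rewrite -seqDU_bigcup_eq; exists i.
case=> j _ Bj; apply: (@subset_seqDU _ A).
exact: (@xgetI _ _ [set i | B i w] j).
Qed.

Lemma measurable_glue d' (V : measurableType d') (N : T -> nat)
    (F : nat -> T -> V) : nat_measurable N ->
  (forall i, measurable_fun setT (F i)) ->
  measurable_fun setT (fun w => F (N w) w).
Proof.
move=> mN mF _ B mB; rewrite setTI.
rewrite (_ : _ @^-1` _ = \bigcup_i (N @^-1` [set i] `&` F i @^-1` B)).
  apply: bigcupT_measurable => i; apply: measurableI => //.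
  by rewrite -[X in measurable X]setTI; exact: mF.
apply/seteqP; split=> w /=; first by move=> ?; exists (N w).
by case=> i _ [/= ->].
Qed.

Lemma geometric_cvg (s : nat -> U) (r : R) : 0 < r ->
  (forall k, `|s k - s k.+1| <= r * 2 ^- k) ->
  exists2 l : U, s @ \oo --> l & `|l - s 0%N| <= 2 * r.
Proof.
move=> r0 sr.
(* The factor [1 - 2 ^- m] is the exact geometric partial sum; the cruder bound [dist'] would not
   pass through the induction. *)
have dist n m : `|s n - s (n + m)%N| <= 2 * r * 2 ^- n * (1 - 2 ^- m).
  elim: m => [|m IH].
    by rewrite addn0 subrr normr0 expr0 invr1 subrr mulr0.
  apply: le_trans (ler_distD (s (n + m)%N) _ _) _.
  rewrite addnS; apply: le_trans (lerD IH (sr _)) _.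
  rewrite exprD exprS !invfM.
  suff -> : 2 * r / 2 ^+ n * (1 - 2 ^- m) + r * (2 ^- n * 2 ^- m) =
    2 * r / 2 ^+ n * (1 - 2^-1 * 2 ^- m) by [].
  by field; rewrite !expf_neq0//.
have dist' n m : `|s n - s (n + m)%N| <= 2 * r * 2 ^- n.
  apply: le_trans (dist n m) _; rewrite ler_piMr//.
    by rewrite !mulr_ge0// ?invr_ge0 ?exprn_ge0// ltW.
have /U_complete : cauchy (s @ \oo).
  apply: cauchy_exP => e e0.
  have [N Ne] : exists N, 2 * r * 2 ^- N < e.
    have /cvgrPdist_lt/(_ (e / (2 * r))) : (fun n => (2^-1 : R) ^+ n) @ \oo --> 0.
      by apply: cvg_expr; rewrite ger0_norm ?invr_ge0// invf_lt1// ltr1n.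
    move=> /(_ (divr_gt0 e0 (mulr_gt0 _ r0)))[]// N _ /(_ N (leqnn _)).
    rewrite sub0r normrN ger0_norm ?exprn_ge0// ltr_pdivlMr ?mulr_gt0// => h.
    by exists N; rewrite mulrC -exprVn.
  exists (s N), N => // m /= Nm; rewrite -ball_normE /=.
  by rewrite -(subnKC Nm); exact: le_lt_trans Ne.
move=> sl; exists (lim (s @ \oo)) => //.
have cn : (fun n => `|s n - s 0%N|) @ \oo --> `|lim (s @ \oo) - s 0%N|.
  by apply: cvg_norm; apply: cvgB => //; exact: cvg_cst.
apply: (cvgr_to_le cn); apply: nearW => n /=; rewrite distrC.
by have := dist' 0%N n; rewrite add0n expr0 invr1 mulr1.
Qed.

Variable S : T -> set U.
Hypothesis S_closed : forall w, closed (S w).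
Hypothesis S_measurable : set_measurable (@measurable d T) S.

Lemma measurable_hits_ball2 (p1 p2 : U) (r1 r2 : R) :
  measurable [set w | exists2 p, S w p & `|p - p1| < r1 /\ `|p - p2| < r2].
Proof.
rewrite (_ : [set w | _] =
    [set w | S w `&` (ball p1 r1 `&` ball p2 r2) !=set0]).
  by apply: S_measurable; apply: openI; exact: ball_open.
apply/seteqP; split=> w /= [p]; rewrite -!ball_normE /=.
  by move=> Sp [? ?]; exists p; split => //; split => /=; rewrite distrC.
by move=> [Sp] /= [? ?]; exists p => //; split; rewrite distrC.
Qed.

Lemma measurable_hits_ball (p1 : U) (r1 : R) :
  measurable [set w | exists2 p, S w p & `|p - p1| < r1].
Proof.
have := measurable_hits_ball2 p1 p1 r1 r1.
rewrite (_ : [set w | _] = [set w | exists2 p, S w p & `|p - p1| < r1])//.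
by apply/seteqP; split=> w [p Sp]; [move=> [? ?]|]; exists p.
Qed.

(** One step of successive approximation: a point of [S w] common to the old ball and to a new ball
    of half the radius bounds the distance between the two centres. *)
Lemma refine_index (r : R) (N : T -> nat) : 0 < r -> nat_measurable N ->
  exists2 N', nat_measurable N' & forall w, `|q (N w) - q (N' w)| <= 2 * r /\
    ((exists2 p, S w p & `|p - q (N w)| < r) ->
     exists2 p, S w p & `|p - q (N' w)| < r / 2).
Proof.
move=> r0 mN.
pose hit w j t := exists2 p, S w p & `|p - q j| < t.
(* The complement keeps the old index where [S w] misses the old ball, so that the sets [A i] cover
   everything and the distance bound holds everywhere. *)
pose A i := \bigcup_j (N @^-1` [set j] `&`
  ([set w | exists2 p, S w p & `|p - q i| < r / 2 /\ `|p - q j| < r] `|`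
   (if j == i then ~` [set w | hit w j r] else set0))).
have mA i : measurable (A i).
  apply: bigcupT_measurable => j; apply: measurableI => //.
  apply: measurableU; first exact: measurable_hits_ball2.
  by case: eqP => // _; apply: measurableC; exact: measurable_hits_ball.
have [N' mN' AN'] := first_index mA.
exists N' => // w.
suff [i /AN'] : exists i, A i w.
  case=> j _ [/= <-] [[p Sp [p1 p2]]|].
    split=> [|_]; last by exists p.
    apply: le_trans (ler_distD p _ _) _.
    rewrite (distrC _ p) mulr_natl mulr2n lerD ?ltW//.
    by rewrite (lt_le_trans p1)// ler_pdivrMr// ler_pMr// ler1n.
  case: eqP => // -> nohit; split=> // .
  by rewrite subrr normr0 mulr_ge0// ltW.
have [[p Sp pN]|nohit] := pselect (hit w (N w) r); last first.
  by exists (N w), (N w) => //; split => //; rewrite eqxx; right.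
have [i pi] := q_dense p (divr_gt0 r0 (ltr0n R 2)).
by exists i, (N w) => //; split => //; left; exists p.
Qed.

(* Kuratowski--Ryll-Nardzewski: a measurable sequence of points of the dense
   sequence whose distance to [S w] tends to 0 geometrically. *)
Lemma ball_selection (i0 : nat) (r : R) : 0 < r ->
  exists2 s : T -> U,
    forall phi : U -> R, continuous phi -> measurable_fun setT (phi \o s) &
    forall w, (exists2 p, S w p & `|p - q i0| < r) ->
      S w (s w) /\ `|s w - q i0| <= 4 * r.
Proof.
move=> r0.
(* Bundling an index function with its measurability turns the dependent choice of refinements into
   plain recursion. *)
pose st := {N : T -> nat | nat_measurable N}.
have r2 k : 0 < r * 2 ^- k by rewrite mulr_gt0// invr_gt0 exprn_gt0.
have step (kN : nat * st) : {N' : st | forall w,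
    `|q (sval kN.2 w) - q (sval N' w)| <= 2 * (r * 2 ^- kN.1) /\
    ((exists2 p, S w p & `|p - q (sval kN.2 w)| < r * 2 ^- kN.1) ->
     exists2 p, S w p & `|p - q (sval N' w)| < r * 2 ^- kN.1.+1)}.
  apply: cid; have [N' mN' hN'] := refine_index (r2 kN.1) (svalP kN.2).
  exists (exist _ N' mN') => w; have [h1 h2] := hN' w; split => //.
  by rewrite exprS invfM (mulrC 2^-1) mulrA.
have mN0 : nat_measurable (fun=> i0) by move=> i; rewrite preimage_cst; case: ifP.
pose N := fix N k : st :=
  if k is k'.+1 then sval (step (k', N k')) else exist _ _ mN0.
have NS k w : `|q (sval (N k) w) - q (sval (N k.+1) w)| <= 2 * r * 2 ^- k /\
    ((exists2 p, S w p & `|p - q (sval (N k) w)| < r * 2 ^- k) ->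
     exists2 p, S w p & `|p - q (sval (N k.+1) w)| < r * 2 ^- k.+1).
  by rewrite -mulrA; exact: (svalP (step (k, N k)) w).
(* The k-th move is at most [2 * r * 2 ^- k]; the moves add up to the [4 * r] of the statement. *)
have r20 : 0 < 2 * r by rewrite mulr_gt0.
have /choice[s sP] : forall w, exists l : U,
    (fun k => q (sval (N k) w)) @ \oo --> l /\ `|l - q i0| <= 4 * r.
  move=> w; have [k|l l1 l2] := @geometric_cvg (fun k => q (sval (N k) w)) _ r20.
    by have [] := NS k w.
  exists l; split => //; apply: le_trans l2 _.
  by rewrite mulrA -natrM.
exists s.
  move=> phi cphi; apply: (@measurable_fun_cvg _ _ _ _
    (fun k w => phi (q (sval (N k) w)))).
    move=> k; apply: (@measurable_glue _ _ (sval (N k)) (fun i _ => phi (q i))).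
      exact: (svalP (N k)).
    by move=> i; exact: measurable_cst.
  by move=> w _; apply: continuous_cvg; [exact: cphi|case: (sP w)].
move=> w [p0 Sp0 p0r]; split; last by case: (sP w).
have hit k : exists2 p, S w p & `|p - q (sval (N k) w)| < r * 2 ^- k.
  elim: k => [|k IH]; first by exists p0; rewrite // expr0 invr1 mulr1.
  by have [_ /(_ IH)] := NS k w.
have /choice[p pP] : forall k, exists p, S w p /\
    `|p - q (sval (N k) w)| < r * 2 ^- k.
  by move=> k; have [p ? ?] := hit k; exists p.
apply: (@closed_cvg _ _ \oo _ p (S w)) => //.
  by apply: nearW => k; case: (pP k).
(* The points [p k] of [S w] and the approximating centres differ by a null sequence, so they share
   their limit. *)
have -> : p = (fun k => (p k - q (sval (N k) w)) + q (sval (N k) w)).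
  by apply/funext => k; rewrite subrK.
rewrite -[s w]add0r; apply: cvgD; last by case: (sP w).
apply/norm_cvg0P/(@squeeze_cvgr _ _ _ _ (cst 0) (fun k => r * 2 ^- k)).
- by apply: nearW => k /=; rewrite normr_ge0 ltW//; case: (pP k).
- exact: cvg_cst.
- rewrite -[0](mulr0 r); apply: cvgM; first exact: cvg_cst.
  under eq_fun do rewrite -exprVn.
  by apply: cvg_expr; rewrite ger0_norm ?invr_ge0// invf_lt1// ltr1n.
Qed.

Variable g : T -> U -> R.
Hypothesis g_cont : forall w, continuous (g w).
Hypothesis g_meas : forall p, measurable_fun setT (g^~ p).

Let pos w := exists2 p, S w p & 0 < g w p.

(** The lower bound on [g] is tested at dense points only, which keeps the set measurable. The
    radius 5 leaves room for [ball_selection], whose values stay within 4 radii of [q i]. *)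
Let good i j : set T :=
  [set w | (exists2 p, S w p & `|p - q i| < j.+1%:R^-1) /\
           forall b, `|q b - q i| < 5 * j.+1%:R^-1 -> j.+1%:R^-1 <= g w (q b)].

Let good_measurable i j : measurable (good i j).
Proof.
rewrite (_ : good i j = [set w | exists2 p, S w p & `|p - q i| < j.+1%:R^-1] `&`
    \bigcap_b [set w | `|q b - q i| < 5 * j.+1%:R^-1 ->
                       j.+1%:R^-1 <= g w (q b)]); last first.
  apply/seteqP; split => [w [h1 h]|w [h1 h]]; split => // b.
    by move=> _; exact: h.
  exact: (h b Logic.I).
apply: measurableI; first exact: measurable_hits_ball.
apply: bigcapT_measurable => b.
have [h|h] := boolP (`|q b - q i| < 5 * j.+1%:R^-1).
  rewrite (_ : [set w | _] = g^~ (q b) @^-1` `[j.+1%:R^-1, +oo[%classic).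
    by rewrite -[X in measurable X]setTI; exact: g_meas.
  by apply/seteqP; split=> w /=; rewrite in_itv /= andbT; [exact|].
by rewrite (_ : [set w | _] = setT)//; apply/seteqP; split.
Qed.

Let good_pos i j w p : good i j w -> `|p - q i| < 5 * j.+1%:R^-1 -> 0 < g w p.
Proof.
move=> [_ gw] pi; rewrite ltNge; apply/negP => gp.
have e0 : 0 < j.+1%:R^-1 :> R by rewrite invr_gt0.
have /cvgrPdist_lt/(_ _ e0) := g_cont (w := w) (x := p).
move=> /nbhs_ballP[t /= t0 tp].
(* The dense point must be close enough to [p] for continuity, and must still lie in the ball around
   [q i] where [g] is tested. *)
have m0 : 0 < Num.min t (5 * j.+1%:R^-1 - `|p - q i|).
  by rewrite lt_min t0 subr_gt0.
have [b] := q_dense p m0; rewrite lt_min => /andP[b1 b2].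
have /gw gb : `|q b - q i| < 5 * j.+1%:R^-1.
  apply: le_lt_trans (ler_distD p _ _) _.
  by rewrite (distrC _ p) -ltrBrDr.
have /= := tp (q b); rewrite -ball_normE /= => /(_ b1).
rewrite ltr_norml => /andP[+ _].
by move: gb gp; set e := j.+1%:R^-1; lra.
Qed.

Let pos_good w : pos w -> exists i j, good i j w.
Proof.
move=> [p Sp gp].
have gp2 : 0 < g w p / 2 by rewrite divr_gt0.
have /cvgrPdist_lt/(_ _ gp2) := g_cont (w := w) (x := p).
move=> /nbhs_ballP[t /= t0 tp].
(* The 6 is 1 + 5: [p] is within one radius of [q i], and a tested [q b] within five. *)
have m0 : 0 < Num.min (t / 6) (g w p / 2) by rewrite lt_min gp2 divr_gt0.
have [j _ /(_ j (leqnn _)) /=] := near_infty_natSinv_lt (PosNum m0).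
rewrite lt_min /= => /andP[j1 j2].
have e0 : 0 < j.+1%:R^-1 :> R by rewrite invr_gt0.
have [i pi] := q_dense p e0.
exists i, j; split=> [|b bi]; first by exists p.
have /tp/= : ball p t (q b).
  rewrite -ball_normE /=; apply: le_lt_trans (ler_distD (q i) _ _) _.
  rewrite (distrC (q i)).
  apply: lt_trans (ltrD pi bi) _.
  by move: j1; rewrite ltr_pdivlMr//; set e := j.+1%:R^-1; lra.
by move: j2; set e := j.+1%:R^-1; rewrite ltr_norml => j2 /andP[_]; lra.
Qed.

(** The countably many sets [good i j] exhaust the points where a solution exists; on each of them
    [ball_selection] solves the problem, and [first_index] pastes these selections. As [U] carries
    no sigma-algebra, measurability of [s] is expressed through continuous real functions, such as
    coordinates. *)
Lemma caratheodory_selection :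
  measurable [set w | exists2 p, S w p & 0 < g w p] /\
  exists2 s : T -> U,
    forall phi : U -> R, continuous phi -> measurable_fun setT (phi \o s) &
    forall w, (exists2 p, S w p & 0 < g w p) -> S w (s w) /\ 0 < g w (s w).
Proof.
split.
  rewrite (_ : [set w | _] = \bigcup_i \bigcup_j good i j).
    by do 2 apply: bigcupT_measurable => ?.
  apply/seteqP; split=> w /=.
    by move=> /pos_good[i [j ?]]; exists i => //; exists j.
  move=> [i _ [j _ gw]]; have [[p Sp pi] _] := gw; exists p => //.
  apply: (good_pos gw); apply: lt_le_trans pi _.
  by rewrite ler_peMl ?invr_ge0// ler1n.
pose A k := if unpickle k is Some (i, j) then good i j else set0.
have mA k : measurable (A k) by rewrite /A; case: unpickle => // -[].
have [N mN NP] := first_index mA.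
have sel k : {s : T -> U |
    (forall phi : U -> R, continuous phi -> measurable_fun setT (phi \o s)) /\
    forall w, A k w -> S w (s w) /\ 0 < g w (s w)}.
  apply: cid; rewrite /A; case: unpickle => [[i j]|]; last first.
    by exists (fun=> 0); split => // phi _; exact: measurable_cst.
  have e0 : 0 < j.+1%:R^-1 :> R by rewrite invr_gt0.
  have [s ms sP] := ball_selection i e0.
  exists s; split=> // w gw; have [/sP[Ss si] _] := gw.
  split => //; apply: (good_pos gw); apply: le_lt_trans si _.
  by rewrite ltr_pM2r// ltr_nat.
exists (fun w => sval (sel (N w)) w).
  move=> phi cphi; apply: (@measurable_glue _ _ N (fun k => phi \o sval (sel k))) => //.
  by move=> k; apply: (svalP (sel k)).1.
move=> w /pos_good[i [j gw]]; apply: (svalP (sel (N w))).2.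
by apply: (NP _ (pickle (i, j))); rewrite /A pickleK.
Qed.

End Selection.

Lemma continuous_radius_dist (R : realType) (U : normedModType R) (c : U) (r : R) :
  continuous (fun p => r - `|p - c|).
Proof.
move=> p; apply: cvgB; first exact: cvg_cst.
by apply: cvg_norm; apply: cvgB; [exact: cvg_id|exact: cvg_cst].
Qed.

(** * Measurability of normal integrands *)

Section RowVectors.
Context (R : realType) (n : nat).
Implicit Types x y v : 'rV[R]_n.

Lemma rV_norm_ler x (M : R) : 0 <= M ->
  (`|x| <= M) <-> (forall j, `|x 0 j| <= M).
Proof.
move=> M0; rewrite [`|x|]mx_normrE; split=> [/bigmax_leP[_ h] j|h].
  exact: (h (0, j)).
by apply/bigmax_leP; split => // -[i j] _ /=; rewrite ord1.
Qed.

Lemma rV_norm_ltr x (M : R) : 0 < M ->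
  (`|x| < M) <-> (forall j, `|x 0 j| < M).
Proof.
move=> M0; rewrite [`|x|]mx_normrE; split=> [/bigmax_ltP[_ h] j|h].
  exact: (h (0, j)).
by apply/bigmax_ltP; split => // -[i j] _ /=; rewrite ord1.
Qed.

Lemma ler_coord_norm x j : `|x 0 j| <= `|x|.
Proof. exact: (rV_norm_ler x (normr_ge0 x)).1. Qed.

Lemma ler_norm_sum_coord x : `|x| <= \sum_j `|x 0 j|.
Proof.
apply/rV_norm_ler => [|j]; first exact: sumr_ge0.
by rewrite (bigD1 j)//= lerDl sumr_ge0.
Qed.

Lemma dotC x y : dot x y = dot y x.
Proof. by apply: eq_bigr => j _; rewrite mulrC. Qed.

Lemma dotDl x y v : dot (x + y) v = dot x v + dot y v.
Proof. by rewrite -big_split; apply: eq_bigr => j _; rewrite mxE mulrDl. Qed.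

Lemma dotDr x y v : dot x (y + v) = dot x y + dot x v.
Proof. by rewrite -!(dotC _ x) dotDl. Qed.

Lemma dotNl x v : dot (- x) v = - dot x v.
Proof. by rewrite -sumrN; apply: eq_bigr => j _; rewrite mxE mulNr. Qed.

Lemma dotNr x v : dot x (- v) = - dot x v.
Proof. by rewrite -!(dotC _ x) dotNl. Qed.

Lemma dotBl x y v : dot (x - y) v = dot x v - dot y v.
Proof. by rewrite dotDl dotNl. Qed.

Lemma dotBr x y v : dot x (y - v) = dot x y - dot x v.
Proof. by rewrite dotDr dotNr. Qed.

Lemma dot0l v : dot 0 v = 0.
Proof. by rewrite /dot big1// => j _; rewrite mxE mul0r. Qed.

Lemma ler_norm_dot x v : `|dot x v| <= n%:R * (`|x| * `|v|).
Proof.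
apply: le_trans (ler_norm_sum _ _ _) _.
apply: (@le_trans _ _ (\sum_(j < n) `|x| * `|v|)); last first.
  by rewrite sumr_const card_ord mulr_natl.
by apply: ler_sum => j _; rewrite normrM ler_pM ?ler_coord_norm.
Qed.

Lemma dot_continuous v : continuous (fun x => dot x v).
Proof.
apply: continuous_big.
  exact: (@pseudometric_normed_Zmodule.add_continuous R R^o).
move=> j _ x.
exact: (cvgM (@coord_continuous R 1 n 0 j x) (cvg_cst (v 0 j : R))).
Qed.

Lemma rV_complete (F : set_system 'rV[R]_n) : ProperFilter F -> cauchy F -> cvg F.
Proof. exact: mx_complete. Qed.

Lemma epi_complete (F : set_system (('rV[R]_n * R^o)%type : normedModType R)) :
  ProperFilter F -> cauchy F -> cvg F.
Proof.
move=> FF cF.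
have c1 : cauchy (fst @ F).
  apply: cauchy_exP => e e0; have /cauchyP/(_ e e0)[p pe] := cF.
  exists p.1; rewrite /fmap /=; apply: (@filterS _ F _ (ball p e)) pe => z.
  by rewrite -!ball_normE /= prod_normE gt_max => /andP[].
have c2 : cauchy (snd @ F).
  apply: cauchy_exP => e e0; have /cauchyP/(_ e e0)[p pe] := cF.
  exists p.2; rewrite /fmap /=; apply: (@filterS _ F _ (ball p e)) pe => z.
  by rewrite -!ball_normE /= prod_normE gt_max => /andP[].
have l1 : fst @ F --> lim (fst @ F) by exact: rV_complete.
have l2 : snd @ F --> lim (snd @ F) by exact: (@R_complete R).
apply/cvg_ex; exists (lim (fst @ F), lim (snd @ F)).
have -> : F = (fun z => (z.1, z.2)) @ F.
  by apply/seteqP; split => A; rewrite /nbhs /= /fmap /=; 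
    apply: filterS => -[].
exact: (cvg_pair l1 l2).
Qed.

Lemma rV_separable :
  exists q : nat -> 'rV[R]_n, forall p (e : R), 0 < e -> exists k, `|p - q k| < e.
Proof.
exists (fun k => if (unpickle k : option 'rV[rat]_n) is Some r
                 then map_mx ratr r else 0) => p e e0.
have /choice[r rP] : forall j, exists r : rat, `|p 0 j - ratr r| < e.
  move=> j; have [|r] := @rat_in_itvoo R (p 0 j - e) (p 0 j + e); first by lra.
  by rewrite in_itv /= => /andP[? ?]; exists r; rewrite ltr_norml; lra.
exists (pickle (\row_j r j : 'rV[rat]_n)); rewrite pickleK.
by apply/rV_norm_ltr => // j; rewrite !mxE.
Qed.

Lemma epi_separable :
  exists q : nat -> 'rV[R]_n * R^o,
    forall p (e : R), 0 < e -> exists k, `|p - q k| < e.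
Proof.
have [q qP] := rV_separable.
exists (fun k => if (unpickle k : option (nat * rat)) is Some (i, r)
                 then (q i, ratr r : R^o) else 0) => -[p a] e e0.
have [i pi] := qP p e e0.
have [|r] := @rat_in_itvoo R (a - e) (a + e); first by lra.
rewrite in_itv /= => /andP[? ?].
exists (pickle (i, r)); rewrite pickleK prod_normE /= gt_max pi /=.
by rewrite ltr_norml; apply/andP; split; lra.
Qed.

End RowVectors.

Section MeasurableVectors.
Context d (T : measurableType d) (R : realType) (n : nat).
Implicit Types x y u : T -> 'rV[R]_n.

(** Relative to the sigma-algebra of the carrier type, so that one notion serves both the ambient
    sigma-algebra and, on [g_sigma_algebraType G], the smaller one. *)
Definition vmeasurable x := forall j, measurable_fun setT (fun w => x w 0 j).

Lemma measurable_fun_in_ifT d' (V : measurableType d') (A : set T) (F G : T -> V) :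
  measurable A -> measurable_fun setT F -> measurable_fun setT G ->
  measurable_fun setT (fun w => if w \in A then F w else G w).
Proof.
move=> mA mF mG; apply: measurable_fun_ifT => //.
apply: (@measurable_fun_bool _ _ _ _ true); rewrite setTI.
rewrite (_ : _ @^-1` _ = A)//.
by apply/seteqP; split=> w; [exact: set_mem|exact: mem_set].
Qed.

Lemma vmeasurable_if (A : set T) x y : measurable A ->
  vmeasurable x -> vmeasurable y ->
  vmeasurable (fun w => if w \in A then x w else y w).
Proof.
move=> mA mx my j.
have := measurable_fun_in_ifT mA (mx j) (my j).
by apply: eq_measurable_fun => w _; case: ifP.
Qed.

Lemma vmeasurableD x y : vmeasurable x -> vmeasurable y ->
  vmeasurable (fun w => x w + y w).
Proof.
move=> mx my j; have := measurable_funD (mx j) (my j).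
by apply: eq_measurable_fun => w _; rewrite mxE.
Qed.

Lemma vmeasurableN x : vmeasurable x -> vmeasurable (fun w => - x w).
Proof.
move=> mx j; have := measurable_funB (measurable_cst (0 : R)) (mx j).
by apply: eq_measurable_fun => w _; rewrite mxE /= sub0r.
Qed.

Lemma vmeasurableB x y : vmeasurable x -> vmeasurable y ->
  vmeasurable (fun w => x w - y w).
Proof. by move=> mx my; apply: vmeasurableD => //; exact: vmeasurableN. Qed.

Lemma vmeasurable_cst (v : 'rV[R]_n) : vmeasurable (fun=> v).
Proof. by move=> j; exact: measurable_cst. Qed.

Lemma measurable_dot x u : vmeasurable x -> vmeasurable u ->
  measurable_fun setT (fun w => dot (x w) (u w)).
Proof.
by move=> mx mu; apply: measurable_sum => j; exact: measurable_funM.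
Qed.

Lemma measurable_rV_norm x : vmeasurable x ->
  measurable_fun setT (fun w => `|x w|).
Proof.
move=> mx; under eq_fun do rewrite [`|_|]mx_normrE.
elim: (index_enum _) => [|ij s IH].
  by under eq_fun do rewrite big_nil; exact: measurable_cst.
under eq_fun do rewrite big_cons; apply: measurable_maxr => //.
apply: measurableT_comp => //.
by case: ij => i j; rewrite ord1; exact: mx.
Qed.

End MeasurableVectors.

(** * Conjugates through the epigraph *)

Section Conjugate.
Context (R : realType) (n : nat).
Implicit Types (phi : 'rV[R]_n -> \bar R) (x v p q : 'rV[R]_n).

Lemma fenchel phi x v : phi x \is a fin_num ->
  ((dot x v)%:E <= phi x + conjugate phi v)%E.
Proof.
move=> phix; rewrite -leeBlDl//; apply: ereal_sup_ubound.
by exists x.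
Qed.

(** This puts the strict superlevel sets of the conjugate into the form required by
    [caratheodory_selection]. *)
Lemma conjugate_gtP phi v (c : R) : (c%:E < conjugate phi v)%E <->
  exists2 p, epigraph phi p & 0 < dot p.1 v - p.2 - c.
Proof.
split=> [/ereal_sup_gt[_ [x _ <-]]|[[x a] /= xa]].
  case phix : (phi x) => [r| |].
  - rewrite -EFinB lte_fin => cr; exists (x, r); rewrite /epigraph /= ?phix//.
    by rewrite subr_gt0.
  - by rewrite /= ltNge leNye.
  (* Where [phi] is [-oo] every height is allowed; one unit below the critical height is chosen. *)
  - move=> _; exists (x, dot x v - c - 1); rewrite /epigraph /= ?phix ?leNye//.
    lra.
move=> xc; apply: (@lt_le_trans _ _ (dot x v - a)%:E).
  by rewrite lte_fin; lra.
apply: (@le_trans _ _ ((dot x v)%:E - phi x)%E).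
  by rewrite EFinB leeB.
by apply: ereal_sup_ubound; exists x.
Qed.

(** With a real bound on the conjugate no sum of opposite infinities arises, so [phi p] may be
    infinite, unlike in [fenchel]. *)
Lemma conjugate_le phi p q (c : R) :
  (conjugate phi q <= c%:E)%E -> ((dot p q - c)%:E <= phi p)%E.
Proof.
move=> phic; have : ((dot p q)%:E - phi p <= c%:E)%E.
  by apply: le_trans phic; apply: ereal_sup_ubound; exists p.
case: (phi p) => [r| |] //=; last by rewrite leey.
by rewrite -EFinB !lee_fin; lra.
Qed.

Lemma le_conjugate phi q (c : R) :
  (forall p, ((dot p q - c)%:E <= phi p)%E) -> (conjugate phi q <= c%:E)%E.
Proof.
move=> h; apply: ge_ereal_sup => _ [p _ <-].
have := h p; case: (phi p) => [r| |] //=; last by rewrite leNye.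
by rewrite -EFinB !lee_fin; lra.
Qed.

End Conjugate.

Section NormalIntegrand.
Context d (T : measurableType d) (R : realType) (n : nat).
Variable f : 'rV[R]_n -> T -> \bar R.
Hypothesis nf : normal_integrand (@measurable d T) f.

Lemma normal_integrand_selection (g : T -> 'rV[R]_n * R^o -> R) :
  (forall w, continuous (g w)) -> (forall p, measurable_fun setT (g^~ p)) ->
  measurable [set w | exists2 p, epigraph (f^~ w) p & 0 < g w p] /\
  exists2 s : T -> 'rV[R]_n * R^o,
    vmeasurable (fst \o s) /\ measurable_fun setT (snd \o s : T -> R) &
    forall w, (exists2 p, epigraph (f^~ w) p & 0 < g w p) ->
      epigraph (f^~ w) (s w) /\ 0 < g w (s w).
Proof.
move=> cg mg; have [q qP] := @epi_separable R n.
have [mA [s ms sP]] := caratheodory_selection qP (@epi_complete R n) nf.1 nf.2 cg mg.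
split=> //; exists s => //; split=> [j|].
  apply: (ms (fun p => p.1 0 j)) => p.
  apply: (@continuous_comp _ _ _ fst (fun x : 'rV[R]_n => x 0 j)).
    exact: cvg_fst.
  exact: coord_continuous.
by apply: (ms snd) => p; exact: cvg_snd.
Qed.

(** The epigraph is closed, so f(x) <= c means that it meets every ball of radius [k.+1%:R^-1]
    around (x, c), a countable condition. *)
Lemma measurable_normal_integrand x : vmeasurable x ->
  measurable_fun setT (fun w => f (x w) w).
Proof.
move=> mx; apply: (measurability _ (ErealGenOInfty.measurableE R)) => //.
move=> _ [_ [c ->] <-]; rewrite setTI.
pose g k w (p : 'rV[R]_n * R^o) := k.+1%:R^-1 - `|p - (x w, c)|.
rewrite (_ : _ @^-1` _ = ~` \bigcap_k
    [set w | exists2 p, epigraph (f^~ w) p & 0 < g k w p]).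
  apply/measurableC/bigcapT_measurable => k.
  apply: (normal_integrand_selection _ _).1 => [w p|p].
    apply: cvgB; first exact: cvg_cst.
    by apply: cvg_norm; apply: cvgB; [exact: cvg_id|exact: cvg_cst].
  apply: measurable_funB; first exact: measurable_cst.
  under eq_fun do rewrite prod_normE /=.
  apply: measurable_maxr; last exact: measurable_cst.
  by apply: measurable_rV_norm; apply: vmeasurableB => //; exact: vmeasurable_cst.
apply/seteqP; split=> w /=; rewrite in_itv /= andbT ltNge.
  move=> /negP fc h; apply: fc.
  have : epigraph (f^~ w) (x w, c : R^o); last by [].
  have [cl _] := nf; apply: cl; move=> B /nbhs_ballP[e /= e0 eB].
  have [k _ /(_ k (leqnn _)) /= ke] := near_infty_natSinv_lt (PosNum e0).
  have [p pf pk] := h k Logic.I; exists p; split => //; apply: eB.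
  rewrite -ball_normE /= distrC.
  by move: pk; rewrite /g subr_gt0 => /lt_trans; exact.
move=> h; apply/negP => fc; apply: h => k _; exists (x w, c) => //.
by rewrite /g subrr normr0 subr0 invr_gt0.
Qed.

Lemma measurable_conjugate u : vmeasurable u ->
  measurable_fun setT (fun w => conjugate (f^~ w) (u w)).
Proof.
move=> mu; apply: (measurability _ (ErealGenOInfty.measurableE R)) => //.
move=> _ [_ [c ->] <-]; rewrite setTI.
rewrite (_ : _ @^-1` _ =
    [set w | exists2 p, epigraph (f^~ w) p & 0 < dot p.1 (u w) - p.2 - c]).
  apply: (normal_integrand_selection _ _).1 => [w p|p].
    apply: cvgB; last exact: cvg_cst.
    apply: cvgB; last exact: cvg_snd.
    apply: (@continuous_comp _ _ _ fst (fun x : 'rV[R]_n => dot x (u w))).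
      exact: cvg_fst.
    exact: dot_continuous.
  do 2 (apply: measurable_funB; last exact: measurable_cst).
  by apply: measurable_dot => //; exact: vmeasurable_cst.
apply/seteqP; split=> w /=; rewrite in_itv /= andbT => /conjugate_gtP//.
Qed.

(** The bound [N] makes the selected point and height integrable. The strict inequality serves two
    purposes: with [b = - Y] it finds points that push the conjugate above [Y], and with a general
    [b] it finds violations of an affine minorant. *)
Lemma epigraph_selection a (b : T -> R) (N : R) : vmeasurable a ->
  measurable_fun setT b ->
  let B := [set w | exists2 p, epigraph (f^~ w) p &
    [/\ `|p.1| < N, `|p.2 : R| < N & p.2 < dot p.1 (a w) + b w]] in
  measurable B /\ exists y, exists2 alpha : T -> R,
    vmeasurable y /\ measurable_fun setT alpha &
    forall w, B w -> [/\ (f (y w) w <= (alpha w)%:E)%E, `|y w| < N,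
      `|alpha w| < N & alpha w < dot (y w) (a w) + b w].
Proof.
move=> ma mb B.
pose g w (p : 'rV[R]_n * R^o) :=
  Num.min (N - `|p|) (dot p.1 (a w) + b w - p.2).
have gP w p : 0 < g w p <->
    [/\ `|p.1| < N, `|p.2 : R| < N & p.2 < dot p.1 (a w) + b w].
  rewrite /g lt_min !subr_gt0 prod_normE gt_max.
  by split=> [/andP[/andP[-> ->] ->]//|[-> -> ->]].
have -> : B = [set w | exists2 p, epigraph (f^~ w) p & 0 < g w p].
  by apply/seteqP; split=> w [p ? /gP ?]; exists p.
have cg w : continuous (g w).
  move=> p; apply: (@continuous_min _ _ (fun p => N - `|p|)
      (fun p => dot p.1 (a w) + b w - p.2)).
    apply: cvgB; first exact: cvg_cst.
    by apply: cvg_norm; exact: cvg_id.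
  apply: cvgB; last exact: cvg_snd.
  apply: cvgD; last exact: cvg_cst.
  apply: (@continuous_comp _ _ _ fst (fun x : 'rV[R]_n => dot x (a w))).
    exact: cvg_fst.
  exact: dot_continuous.
have mg p : measurable_fun setT (g^~ p).
  apply: measurable_minr; first exact: measurable_cst.
  apply: measurable_funB; last exact: measurable_cst.
  apply: measurable_funD => //.
  by apply: measurable_dot => //; exact: vmeasurable_cst.
have [mB [s [ms1 ms2] sP]] := normal_integrand_selection cg mg.
split=> //; exists (fst \o s), (snd \o s); first by split.
by move=> w /sP[es /gP[]].
Qed.

End NormalIntegrand.

(** * Integration and conditional expectation *)

Section SubSigmaAlgebra.
Context d (T : measurableType d) (R : realType) (P : probability T R).
Variable G : set_system T.
Hypothesis hG : is_sub_sigma_algebra G.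

Local Notation TG := (g_sigma_algebraType G).

Lemma sub_measurableE (A : set TG) : measurable A = G A.
Proof. by rewrite (measurable_g_measurableTypeE hG.1). Qed.

Lemma sub_measurableP d' (V : measurableType d') (X : T -> V) :
  sub_measurable G X <-> measurable_fun setT (X : TG -> V).
Proof.
split=> [sX _ B mB|mX B mB]; first by rewrite setTI sub_measurableE; exact: sX.
by rewrite -sub_measurableE -[X in measurable X]setTI; exact: mX.
Qed.

Lemma sub_measurable_measurable d' (V : measurableType d') (X : TG -> V) :
  measurable_fun setT X -> measurable_fun [set: T] X.
Proof. by move=> /sub_measurableP sX _ B mB; rewrite setTI; apply/hG.2/sX. Qed.

Lemma L0P n (x : T -> 'rV[R]_n) : L0 G x <-> vmeasurable (x : TG -> 'rV[R]_n).
Proof. by split=> h j; apply/sub_measurableP; exact: h. Qed.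

Lemma L0_vmeasurable n (x : T -> 'rV[R]_n) : L0 G x -> vmeasurable x.
Proof. by move=> /L0P mx j; exact: sub_measurable_measurable. Qed.

Lemma normal_integrand_sub n (h : 'rV[R]_n -> T -> \bar R) :
  normal_integrand G h ->
  normal_integrand (@measurable _ TG) (h : 'rV[R]_n -> TG -> \bar R).
Proof. by move=> [h1 h2]; split=> // O oO; rewrite sub_measurableE; exact: h2. Qed.

(** Radon-Nikodym on [G]: the charge that integrates [X] over the sets of [G] is dominated by the
    restriction of [P], realized as the image of [P] under the identity from [T] to [TG]. *)
Lemma condexp_exists (X : T -> R) : P.-integrable setT (EFin \o X) ->
  exists Y : T -> R, [/\ sub_measurable G Y, P.-integrable setT (EFin \o Y) &
    forall A, G A -> (\int[P]_(w in A) (X w)%:E = \int[P]_(w in A) (Y w)%:E)%E].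
Proof.
move=> iX.
have mid : measurable_fun [set: T] (idfun : T -> TG).
  by move=> _ B; rewrite sub_measurableE setTI; exact: hG.2.
pose nuT : {charge set T -> \bar R} := induced_charge iX.
pose nu0 (A : set TG) : \bar R := nuT A.
have mG (A : set TG) : measurable A -> @measurable _ T A.
  by rewrite sub_measurableE; exact: hG.2.
have nu00 : nu0 set0 = 0%E by exact: charge0.
have finnu A : measurable A -> nu0 A \is a fin_num.
  by move=> /mG; exact: fin_num_measure.
have addnu : semi_sigma_additive nu0.
  move=> F mF tF mUF; apply: (@charge_semi_sigma_additive _ _ _ nuT) => //.
    by move=> k; exact: mG.
  exact: mG.
pose nu : {charge set TG -> \bar R} :=
  HB.pack nu0 (isCharge.Build _ _ _ nu0 nu00 finnu addnu).
pose pid : {mfun T >-> TG} := HB.pack (idfun : T -> TG)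
  (isMeasurableFun.Build _ _ _ _ (idfun : T -> TG) mid).
pose PG : probability TG R := distribution P pid.
have dom : nu `<< PG.
  apply/null_content_dominatesP => A mA PA.
  apply: null_set_integral => //; first exact: mG.
  by apply: measurable_funTS; exact: measurable_int iX.
pose Y := Radon_Nikodym nu PG.
have finY w : Y w \is a fin_num by exact: Radon_Nikodym_fin_num.
have iY := Radon_Nikodym_integrable dom.
have mY := measurable_int _ iY.
have iYT : P.-integrable setT (Y : T -> \bar R).
  apply/integrableP; split; first exact: sub_measurable_measurable.
  move/integrableP: iY => [_]; apply: le_lt_trans.
  rewrite (ge0_integral_distribution pid)//; exact: measurableT_comp.
exists (fine \o Y); split.
- apply/sub_measurableP; apply: measurableT_comp => //.

- rewrite (_ : _ \o _ = Y)//; apply/funext => w /=; exact: fineK.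
- move=> A GA; have mA : @measurable _ TG A by rewrite sub_measurableE.
  transitivity (nu A); first by [].
  rewrite (Radon_Nikodym_integral dom mA).
  rewrite (@integral_pushforward _ _ _ _ _ _ mid P A Y mY)//.
    by apply: eq_integral => w _; rewrite /= fineK.
  by apply: integrableS iYT => //; exact: mG.
Qed.

End SubSigmaAlgebra.

Section IntegralFacts.
Context d (T : measurableType d) (R : realType) (P : probability T R).
Implicit Types (A : set T) (F : T -> R) (X Z : T -> \bar R).

Lemma ae_le_integral A X Z : measurable A -> measurable_fun A X ->
  measurable_fun A Z -> {ae P, forall w, A w -> (X w <= Z w)%E} ->
  (\int[P]_(w in A) X w <= \int[P]_(w in A) Z w)%E.
Proof.
move=> mA mX mZ XZ; rewrite integralE [leRHS]integralE; apply: leeB.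
  apply: ae_ge0_le_integral => //; try exact: measurable_funepos.
  apply: filterS XZ => w XZ /XZ h.
  by rewrite !funeposE ge_max !le_max h lexx orbT.
apply: ae_ge0_le_integral => //; try exact: measurable_funeneg.
apply: filterS XZ => w XZ /XZ h.
by rewrite !funenegE ge_max !le_max leeN2 h lexx orbT.
Qed.

Lemma fin_num_integrable A X : measurable A -> measurable_fun A X ->
  (\int[P]_(w in A) X w)%E \is a fin_num -> P.-integrable A X.
Proof.
move=> mA mX h; apply/integrableP; split => //.
by apply/(abse_integralP P mA mX); rewrite -fin_num_abs.
Qed.

Lemma ae_le_Rintegral A F1 F2 : measurable A ->
  P.-integrable A (EFin \o F1) -> P.-integrable A (EFin \o F2) ->
  {ae P, forall w, A w -> F1 w <= F2 w} ->
  \int[P]_(w in A) F1 w <= \int[P]_(w in A) F2 w.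
Proof.
move=> mA i1 i2 F12; apply: fine_le; try exact: integrable_fin_num.
by apply: ae_le_integral => //; [exact: measurable_int i1|exact: measurable_int i2].
Qed.

Lemma EFin_Rintegral A F : measurable A -> P.-integrable A (EFin \o F) ->
  (\int[P]_(w in A) (F w)%:E = (\int[P]_(w in A) F w)%:E)%E.
Proof. by move=> mA iF; rewrite fineK//; exact: integrable_fin_num. Qed.

Lemma ae_fineK A X : measurable A -> P.-integrable A X ->
  {ae P, forall w, A w -> X w = (fine (X w))%:E}.
Proof. by move=> mA /(integrable_ae mA); apply: filterS => w h /h /fineK. Qed.

Lemma integrable_fine A X : measurable A -> P.-integrable A X ->
  P.-integrable A (EFin \o (fine \o X)).
Proof.
move=> mA iX; have mX := measurable_int _ iX.
apply: le_integrable iX => //.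
  by apply/measurable_EFinP; exact: measurableT_comp.
by move=> w Aw /=; case: (X w) => [r| |]; rewrite ?leey.
Qed.

Lemma integral_fine A X : measurable A -> P.-integrable A X ->
  (\int[P]_(w in A) X w)%E = (\int[P]_(w in A) fine (X w))%:E.
Proof.
move=> mA iX; rewrite -EFin_Rintegral//; last exact: integrable_fine.
apply: ae_eq_integral => //; try exact: measurable_int iX.
  exact: measurable_int (integrable_fine mA iX).
exact: ae_fineK.
Qed.

Lemma ae_eq_integrable A X Z : measurable A -> measurable_fun A Z ->
  {ae P, forall w, A w -> X w = Z w} -> P.-integrable A X -> P.-integrable A Z.
Proof.
move=> mA mZ XZ iX; apply: fin_num_integrable => //.
suff <- : (\int[P]_(w in A) X w = \int[P]_(w in A) Z w)%E.
  exact: integrable_fin_num.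
by apply: ae_eq_integral => //; exact: measurable_int iX.
Qed.

Lemma ae_le_integrable A X Z : measurable A -> measurable_fun A X ->
  {ae P, forall w, A w -> (`|X w| <= `|Z w|)%E} ->
  P.-integrable A Z -> P.-integrable A X.
Proof.
move=> mA mX XZ /integrableP[mZ iZ]; apply/integrableP; split => //.
apply: le_lt_trans iZ; apply: ae_le_integral => //; exact: measurableT_comp.
Qed.

Lemma bounded_mul_integrable A F1 F2 (M : R) : measurable A ->
  measurable_fun A F1 -> (forall w, A w -> `|F1 w| <= M) ->
  P.-integrable A (EFin \o F2) -> P.-integrable A (EFin \o (F1 \* F2)).
Proof.
move=> mA m1 b1 i2; have := integrableZl mA M i2.
apply: le_integrable => //.
  apply/measurable_EFinP/measurable_funM => //.
  by apply/measurable_EFinP; exact: measurable_int i2.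
move=> w Aw /=; rewrite lee_fin !normrM ler_wpM2r//.
exact: le_trans (b1 w Aw) (ler_norm _).
Qed.

Lemma bounded_integrable A F (M : R) : measurable A -> measurable_fun A F ->
  (forall w, A w -> `|F w| <= M) -> P.-integrable A (EFin \o F).
Proof.
move=> mA mF bF; apply: measurable_bounded_integrable => //.
  exact: le_lt_trans (probability_le1 _ mA) (ltry 1).
exists M; split; first exact: num_real.
by move=> x Mx w /bF /le_trans; apply; exact: ltW.
Qed.

Lemma ge0_Rintegral_le0 A F : measurable A -> P.-integrable A (EFin \o F) ->
  {ae P, forall w, A w -> 0 <= F w} -> \int[P]_(w in A) F w <= 0 ->
  {ae P, forall w, A w -> F w = 0}.
Proof.
move=> mA iF F0 F1; have mF := measurable_int _ iF.
have : (\int[P]_(w in A) `|(F w)%:E| = 0)%E.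
  rewrite (_ : (\int[P]_(w in A) _)%E = (\int[P]_(w in A) (F w)%:E)%E).
    rewrite EFin_Rintegral//; congr EFin; apply/eqP.
    rewrite eq_le F1 /= -(_ : \int[P]_(w in A) (cst 0 w) = 0); last first.
      by rewrite Rintegral_cst// mul0r.
    apply: ae_le_Rintegral => //.
    by apply: (@bounded_integrable _ _ 0) => // w _; rewrite normr0.
  apply: ae_eq_integral => //; first exact: measurableT_comp.
  by apply: filterS F0 => w h Aw; rewrite gee0_abs// lee_fin h.
move=> /(ae_eq_integral_abs P mA mF).1; apply: filterS => w h Aw.
by case: (h Aw).
Qed.

End IntegralFacts.

(** * Integrable and essentially bounded vectors *)

Section LpSpaces.
Context d (T : measurableType d) (R : realType) (P : probability T R).
Variables (n : nat) (H : set_system T).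
Hypothesis hH : is_sub_sigma_algebra H.
Implicit Types x v : T -> 'rV[R]_n.

Lemma Lp1P v : Lp P H 1%E v <->
  L0 H v /\ forall j, P.-integrable setT (EFin \o (fun w => v w 0 j)).
Proof.
rewrite /Lp /= /finite_norm Lnorm1; split=> [[Lv fin]|[Lv iv]].
  have mv := L0_vmeasurable hH Lv; split=> // j; apply/integrableP; split.
    exact/measurable_EFinP.
  apply: le_lt_trans fin; apply: ge0_le_integral => //.
  - by apply: measurableT_comp => //; exact/measurable_EFinP.
  - apply: measurableT_comp => //; apply/measurable_EFinP.
    exact: measurable_rV_norm.
  - by move=> w _ /=; rewrite lee_fin normr_id ler_coord_norm.
have mv := L0_vmeasurable hH Lv; split=> //.
have /integrableP[_] : P.-integrable setT
    (fun w => \sum_(j < n) `|(v w 0 j)%:E|)%E.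
  by apply: integrable_sum => // j _; exact: (integrable_abse (iv j)).
apply: le_lt_trans; apply: ge0_le_integral => //.
- apply: measurableT_comp => //; apply/measurable_EFinP.
  exact: measurable_rV_norm.
- apply: measurableT_comp => //; apply: emeasurable_sum => j.
  by apply: measurableT_comp => //; exact/measurable_EFinP.
- move=> w _ /=; rewrite sumEFin /= lee_fin normr_id.
  by rewrite ger0_norm ?sumr_ge0// ler_norm_sum_coord.
Qed.

Lemma norm_integrable v : Lp P H 1%E v ->
  P.-integrable setT (EFin \o (fun w => `|v w|)).
Proof.
move=> [Lv]; rewrite /finite_norm Lnorm1 => fin; apply/integrableP; split=> //.
by apply/measurable_EFinP/measurable_rV_norm; exact: L0_vmeasurable Lv.
Qed.

Lemma ae_bounded_Lpoo x (M : R) : L0 H x -> {ae P, forall w, `|x w| <= M} ->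
  Lp P H +oo%E x.
Proof.
move=> Lx xM; split=> //; rewrite /finite_norm Lnorm.unlock.
have -> : (0 < P setT)%E by rewrite probability_setT lte01.
apply: (@le_lt_trans _ _ M%:E); last exact: ltry.
by apply/ess_supP; apply: filterS xM => w; rewrite /= lee_fin normr_id.
Qed.

(** Cutting [x] to 0 above its essential supremum changes it on a null set only and yields a bound
    valid everywhere. *)
Lemma Lpoo_bounded x : Lp P H +oo%E x -> exists x', exists2 M,
  L0 H x' /\ (forall w, `|x' w| <= M) & {ae P, forall w, x w = x' w}.
Proof.
move=> [Lx]; rewrite /finite_norm Lnorm.unlock.
have -> : (0 < P setT)%E by rewrite probability_setT lte01.
have := ess_sup_ge P (abse \o (EFin \o (fun w => `|x w|))).
set s := ess_sup _ _ => xs s_oo.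
have sM : (s <= (Num.max (fine s) 0)%:E)%E.
  by case: s s_oo {xs} => [r| |]//= _; rewrite ?leNye// lee_fin le_max lexx.
(* The maximum with 0 makes the bound hold also for the value 0 taken outside [A]. *)
pose M := Num.max (fine s) 0.
pose A := [set w | `|x w| <= M].
have mx := (L0P hH x).1 Lx.
have mA : measurable (A : set (g_sigma_algebraType H)).
  rewrite (_ : A = (fun w => `|x w|) @^-1` `]-oo, M]%classic).
    by rewrite -[X in measurable X]setTI; exact: measurable_rV_norm.
  by apply/seteqP; split=> w; rewrite /A /= in_itv.
exists (fun w => if w \in A then x w else 0), M.
  split.
    by apply/(L0P hH _)/vmeasurable_if => //; exact: vmeasurable_cst.
  move=> w; case: ifPn => [/set_mem//|_].
  by rewrite normr0 /M le_max lexx orbT.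
apply: filterS xs => w xs; rewrite mem_set// /A /=.
have := le_trans xs sM.
by rewrite /= lee_fin normr_id.
Qed.

Lemma dot_integrable A x v (M : R) : measurable A -> vmeasurable x ->
  (forall w, A w -> `|x w| <= M) -> Lp P H 1%E v ->
  P.-integrable A (EFin \o (fun w => dot (x w) (v w))).
Proof.
move=> mA mx bx /Lp1P[_ iv].
have : P.-integrable A (fun w => \sum_(j < n) (x w 0 j * v w 0 j)%:E)%E.
  apply: integrable_sum => // j _.
  apply: (@bounded_mul_integrable _ _ _ _ _ (fun w => x w 0 j) (fun w => v w 0 j) M) => //.
  - exact: measurable_funTS.
  - by move=> w /bx; apply: le_trans; exact: ler_coord_norm.
  - exact: integrableS (iv j).
by apply: eq_integrable => // w _ /=; rewrite sumEFin.
Qed.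

End LpSpaces.

(* The sum is the integer part of [t], in layer-cake form. *)
Lemma sum_indic_ler (R : realType) (t : R) (N : nat) : 0 <= t -> t <= N%:R ->
  `|t - \sum_(i < N) (i.+1%:R <= t)%R%:R| <= 1.
Proof.
move=> t0; pose S N : R := \sum_(i < N) (i.+1%:R <= t)%R%:R.
have SS k : S k.+1 = S k + (k.+1%:R <= t)%R%:R by rewrite /S big_ord_recr.
(* The induction also needs the exact value of the sum while [t] is still beyond all its
   thresholds. *)
suff : (N%:R <= t -> S N = N%:R) /\ (t <= N%:R -> `|t - S N| <= 1) by case.
elim: N => [|N [IH1 IH2]].
  rewrite /S big_ord0; split=> // h; rewrite subr0 ger0_norm//.
  exact: le_trans h ler01.
rewrite SS; split=> h.
  by rewrite IH1 ?h ?natr1//; apply: le_trans h; rewrite ler_nat.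
have [tN|tN] := leP N.+1%:R t.
  have -> : t = N.+1%:R by apply/eqP; rewrite eq_le h tN.
  by rewrite IH1 ?natr1 ?subrr ?normr0//; apply: le_trans tN; rewrite ler_nat.
rewrite addr0; have [Nt|Nt] := leP N%:R t; last by apply: IH2; exact: ltW.
rewrite IH1// ger0_norm ?subr_ge0//.
by rewrite lerBlDl natr1.
Qed.

(** * Taking out bounded factors *)

Section PullOut.
Context d (T : measurableType d) (R : realType) (P : probability T R).
Variable G : set_system T.
Hypothesis hG : is_sub_sigma_algebra G.
Local Notation TG := (g_sigma_algebraType G).

Let GT (A : set T) : G A -> measurable A := @hG.2 A.

(** Scale [y] by [k.+1%:R] and round down: the rounded function is a sum of indicators of sets of
    [G], hence contributes 0, and the rounding error is at most 1. Thus [k.+1%:R] times the absolute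
    value of the integral stays below the L^1 norm of [F] for every [k], which forces the integral
    to vanish. *)
Let pull_out_ge0 (F y : T -> R) (M : R) : P.-integrable setT (EFin \o F) ->
  (forall A, G A -> \int[P]_(w in A) F w = 0) ->
  sub_measurable G y -> (forall w, 0 <= y w <= M) ->
  \int[P]_w (y w * F w) = 0.
Proof.
move=> iF F0 sy yM.
have my : measurable_fun [set: T] y.
  exact: (sub_measurable_measurable hG (proj1 (sub_measurableP hG y) sy)).
have mF : measurable_fun setT F by apply/measurable_EFinP; exact: measurable_int iF.
have iyF : P.-integrable setT (EFin \o (y \* F)).
  apply: (bounded_mul_integrable _ _ (M := M)) => // w _.
  by have /andP[? ?] := yM w; rewrite ger0_norm.
set I := \int[P]_w (y w * F w).
pose C := \int[P]_w `|F w|.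
have iaF : P.-integrable setT (EFin \o (fun w => `|F w|)).
  exact: (integrable_abse iF).
suff IC k : `|I| * k.+1%:R <= C.
  apply/eqP; rewrite -normr_le0 leNgt; apply/negP => I0.
  have /(_ (C / `|I|)) [k kC] : forall x : R, exists k : nat, x < k.+1%:R.
    move=> x; exists (Num.truncn x); exact: truncnS_gt.
  by rewrite ltr_pdivrMr// mulrC ltNge IC in kC.
pose t w := k.+1%:R * y w.
(* Enough layers to reach the upper bound [k.+1%:R * M] of [t]. *)
pose N := (Num.truncn (k.+1%:R * M)).+1.
pose A i := [set w | i.+1%:R <= t w].
have GA i : G (A i).
  rewrite (_ : A i = y @^-1` `[i.+1%:R / k.+1%:R, +oo[%classic); first exact: sy.
  apply/seteqP; split=> w; rewrite /A /t /= in_itv /= andbT;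
    by rewrite ler_pdivrMr// mulrC.
pose s w := \sum_(i < N) (i.+1%:R <= t w)%R%:R : R.
have iA i : P.-integrable setT (EFin \o (F \_ (A i))).
  rewrite -restrict_EFin; apply/(integrable_mkcond _ _).1; first exact: GT.
  by apply: integrableS iF => //; exact: GT.
have sF w : s w * F w = \sum_(i < N) (F \_ (A i)) w.
  rewrite mulr_suml; apply: eq_bigr => i _; rewrite patchE.
  case: ifPn => [/set_mem|/negP].
    by rewrite /A /= => ->; rewrite mul1r.
  rewrite inE /A /= => /negP/negbTE ->; rewrite mul0r//.
have isF : P.-integrable setT (EFin \o (fun w => s w * F w)).
  have : P.-integrable setT (fun w => \sum_(i < N) (EFin \o F \_ (A i)) w)%E.
    by apply: integrable_sum.
  by apply: eq_integrable => // w _; rewrite /= sF sumEFin.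
have s0 : \int[P]_w (s w * F w) = 0.
  rewrite /Rintegral (_ : (\int[P]_w _)%E = 0%E)//.
  transitivity (\int[P]_w (\sum_(i < N) (EFin \o F \_ (A i)) w))%E.
    by apply: eq_integral => w _; rewrite /= sF sumEFin.
  rewrite integral_sum// big1// => i _.
  rewrite EFin_Rintegral// -Rintegral_mkcond F0//.
have tN w : `|t w - s w| <= 1.
  have /andP[y0 yMw] := yM w; apply: sum_indic_ler; rewrite /t.
    by rewrite mulr_ge0.
  apply: le_trans (ltW (truncnS_gt _)); by rewrite ler_pM2l.
have -> : `|I| * k.+1%:R = `|\int[P]_w ((t w - s w) * F w)|.
  have -> : \int[P]_w ((t w - s w) * F w) = \int[P]_w (k.+1%:R * (y w * F w) - s w * F w).
    by apply: eq_Rintegral => w _; rewrite /t; ring.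
  rewrite RintegralB//; last exact: (integrableZl _ _ iyF).
  by rewrite s0 subr0 RintegralZl// normrM normr_nat mulrC.
have iG : P.-integrable setT (EFin \o (fun w => (t w - s w) * F w)).
  have := integrableB measurableT (integrableZl measurableT k.+1%:R iyF) isF.
  by apply: eq_integrable => // w _ /=; rewrite -EFinM -EFinB /t; congr EFin; ring.
apply: le_trans (le_normr_Rintegral _ iG) _ => //.
apply: le_Rintegral => //; first exact: (integrable_abse iG).
by move=> w _; rewrite normrM ler_piMl.
Qed.

Lemma pull_out (F y : T -> R) (M : R) : P.-integrable setT (EFin \o F) ->
  (forall A, G A -> \int[P]_(w in A) F w = 0) ->
  sub_measurable G y -> (forall w, `|y w| <= M) ->
  \int[P]_w (y w * F w) = 0.
Proof.
move=> iF F0 sy yM.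
(* Adding the constant [M] makes the factor nonnegative and changes the integral by [M] times the
   integral of [F] over the whole space, which is 0. *)
have syM : sub_measurable G (fun w => y w + M).
  apply/(sub_measurableP hG)/measurable_funD => //.
  exact/(sub_measurableP hG).
have := pull_out_ge0 (M := M + M) iF F0 syM.
have my : measurable_fun [set: T] y.
  exact: (sub_measurable_measurable hG (proj1 (sub_measurableP hG y) sy)).
have -> : \int[P]_w ((y w + M) * F w) = \int[P]_w (y w * F w + M * F w).
  by apply: eq_Rintegral => w _; rewrite mulrDl.
rewrite RintegralD//; last 2 first.
- exact: (bounded_mul_integrable _ _ (fun w _ => yM w)).
- exact: (integrableZl _ _ iF).
rewrite RintegralZl// F0 ?mulr0 ?addr0; last first.
  by rewrite -(sub_measurableE hG).
apply=> w; have := yM w; rewrite ler_norml => /andP[? ?].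
by apply/andP; split; lra.
Qed.

End PullOut.

Section ConditionalExpectation.
Context d (T : measurableType d) (R : realType) (P : probability T R).
Variables (G : set_system T) (n : nat).
Hypothesis hG : is_sub_sigma_algebra G.
Local Notation F := (@measurable d T).
Implicit Types u v y : T -> 'rV[R]_n.

Let GT (A : set T) : G A -> measurable A := @hG.2 A.

Lemma measurable_sub_sigma_algebra : is_sub_sigma_algebra F.
Proof.
split=> //; split; [exact: measurable0| |].
- by move=> A mA; rewrite setTD; exact: measurableC.
- by move=> A mA; exact: bigcupT_measurable.
Qed.

Lemma integrable_is_condexp (X Y : T -> \bar R) : P.-integrable setT X ->
  sub_measurable G Y ->
  (forall A, G A -> (\int[P]_(w in A) X w = \int[P]_(w in A) Y w)%E) ->
  is_condexp P G X Y.
Proof.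
move=> iX sY XY; split=> //; first exact: measurable_int iX.
by left; exact: integrable_funepos.
Qed.

Lemma condexp_vec_exists v : Lp P F 1%E v ->
  exists2 u, Lp P G 1%E u & is_condexp_vec P G v u.
Proof.
move=> /(Lp1P P measurable_sub_sigma_algebra)[_ iv].
have /choice[Y YP] : forall j, exists Y : T -> R,
    [/\ sub_measurable G Y, P.-integrable setT (EFin \o Y) &
    forall A, G A -> (\int[P]_(w in A) (v w 0 j)%:E = \int[P]_(w in A) (Y w)%:E)%E].
  by move=> j; exact: (condexp_exists hG (iv j)).
exists (fun w => \row_j Y j w).
  apply/(Lp1P P hG); split=> j; have [sY iY _] := YP j.
    by rewrite (_ : (fun w => _) = Y j)//; apply/funext => w; rewrite mxE.
  by apply: eq_integrable iY => // w _ /=; rewrite mxE.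
move=> j; have [sY iY YE] := YP j.
have -> : (fun w => ((\row_j Y j w) 0 j)%:E) = EFin \o Y j.
  by apply/funext => w; rewrite mxE.
apply: integrable_is_condexp => //; first exact: iv.
move=> B mB; rewrite comp_preimage; apply: sY.
by rewrite -[X in measurable X]setTI; exact: EFin_measurable.
Qed.

(** Once [y] is replaced by 0 outside [A], its coordinates are bounded and [pull_out] applies to the
    differences [v w 0 j - u w 0 j], whose integrals over sets of [G] vanish. *)
Lemma condexp_vec_dot v u y A (M : R) : Lp P F 1%E v -> Lp P G 1%E u ->
  is_condexp_vec P G v u -> L0 G y -> G A -> (forall w, A w -> `|y w| <= M) ->
  \int[P]_(w in A) dot (y w) (v w) = \int[P]_(w in A) dot (y w) (u w).
Proof.
move=> Lv Lu vu Ly GA yM; have mA := GT GA.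
have [_ iv] := (Lp1P P measurable_sub_sigma_algebra _).1 Lv.
have [_ iu] := (Lp1P P hG _).1 Lu.
pose y' w := if w \in A then y w else 0.
have Ly' : L0 G y'.
  apply/(L0P hG)/vmeasurable_if; first by rewrite (sub_measurableE hG).
    exact/(L0P hG).
  exact: vmeasurable_cst.
have y'M w : `|y' w| <= Num.max M 0.
  rewrite /y'; case: ifPn => [/set_mem/yM h|_].
    by rewrite le_max h.
  by rewrite normr0 le_max lexx orbT.
have my' := L0_vmeasurable hG Ly'.
have y'E z : \int[P]_(w in A) dot (y w) (z w) = \int[P]_w dot (y' w) (z w).
  rewrite Rintegral_mkcond; apply: eq_Rintegral => w _.
  by rewrite patchE /y'; case: ifP => // _; rewrite dot0l.
rewrite !y'E; apply/eqP; rewrite -subr_eq0 -RintegralB//; last 2 first.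
- exact: (dot_integrable measurable_sub_sigma_algebra _ my' (fun w _ => y'M w)).
- exact: (dot_integrable hG _ my' (fun w _ => y'M w)).
have iy j : P.-integrable setT (EFin \o (fun w => y' w 0 j * (v w 0 j - u w 0 j))).
  apply: (bounded_mul_integrable _ _ (M := Num.max M 0)) => //.
    by move=> w _; apply: le_trans (y'M w); exact: ler_coord_norm.
  by have := integrableB measurableT (iv j) (iu j).
apply/eqP; rewrite /Rintegral.
rewrite (_ : (\int[P]_w _)%E =
  (\int[P]_w \sum_(j < n) (y' w 0 j * (v w 0 j - u w 0 j))%:E)%E); last first.
  apply: eq_integral => w _; rewrite sumEFin; congr EFin.
  by rewrite /dot -sumrB; apply: eq_bigr => j _; rewrite mulrBr.
rewrite integral_sum// big1// => j _.
rewrite EFin_Rintegral//; congr EFin.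
apply: (pull_out hG (M := Num.max M 0)).
- by have := integrableB measurableT (iv j) (iu j).
- move=> B GB; have mB := GT GB.
  rewrite RintegralB//; try by [exact: integrableS (iv j)|exact: integrableS (iu j)].
  have [_ _ _ /(_ B GB)] := vu j.
  by rewrite /Rintegral => ->; rewrite subrr.
- exact: Ly'.
- by move=> w; apply: le_trans (y'M w); exact: ler_coord_norm.
Qed.

End ConditionalExpectation.

(** * Integrands under conditional expectation *)

Section Integrand.
Context d (T : measurableType d) (R : realType) (P : probability T R) (n : nat).
Variable f : 'rV[R]_n -> T -> \bar R.
Hypothesis nf : normal_integrand (@measurable d T) f.
Implicit Types (A : set T) (x y u v : T -> 'rV[R]_n).
Local Notation F := (@measurable d T).
Local Notation conjf y := (fun w => conjugate (f^~ w) (y w)).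

Lemma integrable_posneg A (X : T -> \bar R) : measurable A ->
  P.-integrable A X^\+%E -> P.-integrable A X^\-%E -> P.-integrable A X.
Proof.
move=> mA ip iN; have := integrableB mA ip iN.
apply: eq_integrable => // w _ /=.
by have /(congr1 (@^~ w)) /= <- := funeposneg X.
Qed.

Lemma Eext_lty (X : T -> \bar R) : (Eext P X < +oo)%E -> P.-integrable setT X^\+%E.
Proof. by rewrite /Eext; case: asboolP. Qed.

(** Fenchel's inequality in a form that survives infinite values: the left side is 0 where f(x) is
    [+oo], and the conjugate is [+oo] where f(x) is [-oo]. *)
Lemma negpart_le x v (w : T) :
  ((fun w => f (x w) w)^\- w <=
   `|(dot (x w) (v w))%:E| + (fun w => conjugate (f^~ w) (v w))^\+ w)%E.
Proof.
rewrite funenegE funeposE.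
have r0 r : (0 <= `|(dot (x w) (v w))%:E| + maxe r 0)%E.
  by rewrite adde_ge0// le_max lexx orbT.
case fx : (f (x w) w) => [r| |]; last 2 first.
- by rewrite /= max_r ?leNye.
- rewrite [conjugate _ _](_ : _ = +oo%E) ?max_l ?leey//.
  apply/eqP; rewrite -leye_eq; apply: ereal_sup_ubound.
  by exists (x w) => //; rewrite fx.
rewrite ge_max r0 andbT.
have := @fenchel _ _ (f^~ w) (x w) (v w); rewrite fx => /(_ isT).
case: (conjugate _ _) => [c| |]//= h; last by rewrite max_l ?leey// addey.
rewrite -EFin_max.
suff : - r <= `|dot (x w) (v w)| + Num.max c 0 by rewrite -lee_fin.
move: h; rewrite -EFinD lee_fin => h.
have := ler_norm (dot (x w) (v w)); rewrite -normrN.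
have := ler_norm (- dot (x w) (v w)).
have : c <= Num.max c 0 by rewrite le_max lexx.
lra.
Qed.

Variable v0 : T -> 'rV[R]_n.
Hypothesis Lv0 : Lp P F 1%E v0.
Hypothesis Efv0 : (Eint P (fun p w => conjugate (f^~ w) p) v0 < +oo)%E.

Let hF := measurable_sub_sigma_algebra T.

Lemma negpart_integrable A x (M : R) : measurable A -> vmeasurable x ->
  (forall w, A w -> `|x w| <= M) ->
  P.-integrable A (fun w => f (x w) w)^\-%E.
Proof.
move=> mA mx xM.
have i1 := dot_integrable hF mA mx xM Lv0.
have i2 := integrableS measurableT mA (@subsetT _ A) (Eext_lty Efv0).
have := integrableD mA (integrable_abse i1) i2.
apply: le_integrable => //.
  apply: measurable_funeneg; apply: measurable_funTS.
  exact: measurable_normal_integrand.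
move=> w Aw /=; rewrite [leRHS]gee0_abs ?adde_ge0// gee0_abs//.
exact: negpart_le.
Qed.

Lemma bounded_integrand_integrable A x (M : R) : measurable A -> vmeasurable x ->
  (forall w, A w -> `|x w| <= M) -> P.-integrable A (fun w => f (x w) w)^\+%E ->
  P.-integrable A (fun w => f (x w) w).
Proof.
move=> mA mx xM ip; apply: integrable_posneg => //.
exact: negpart_integrable xM.
Qed.

Variable x0 : T -> 'rV[R]_n.
Variable M0 : R.
Hypothesis mx0 : vmeasurable x0.
Hypothesis x0M : forall w, `|x0 w| <= M0.
Hypothesis fx0 : P.-integrable setT (fun w => f (x0 w) w).

(** Interchange of supremum and integral. Only bounded [y] with integrable f(y) are allowed as
    competitors, so the conjugate is reached from below: first by integrable functions strictly
    under it, then by truncation and monotone convergence. *)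
Lemma conjugate_interchange u (c : R) : Lp P F 1%E u ->
  (forall y M, vmeasurable y -> (forall w, `|y w| <= M) ->
    P.-integrable setT (fun w => f (y w) w) ->
    - c <= \int[P]_w (fine (f (y w) w) - dot (y w) (u w))) ->
  P.-integrable setT (conjf u) /\ (\int[P]_w conjugate (f^~ w) (u w) <= c%:E)%E.
Proof.
move=> Lu hc.
have mu : vmeasurable u by apply: (L0_vmeasurable hF); case: Lu.
have mfx y : vmeasurable y -> measurable_fun setT (fun w => f (y w) w).
  exact: measurable_normal_integrand.
pose g := conjf u.
have mg : measurable_fun setT g by exact: measurable_conjugate.
(* An integrable minorant of [g], by Fenchel's inequality at the base point. *)
pose l w := dot (x0 w) (u w) - fine (f (x0 w) w).
have idot y M : vmeasurable y -> (forall w, `|y w| <= M) ->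
    P.-integrable setT (EFin \o (fun w => dot (y w) (u w))).
  by move=> my yM; apply: (dot_integrable hF _ my _ Lu) => // w _; exact: yM.
have il : P.-integrable setT (EFin \o l).
  have := integrableB measurableT (idot _ _ mx0 x0M) (integrable_fine measurableT fx0).
  exact: eq_integrable.
have ml : measurable_fun setT l by apply/measurable_EFinP; exact: measurable_int il.
have step1 (Y : T -> R) : P.-integrable setT (EFin \o Y) ->
    {ae P, forall w, ((Y w)%:E < g w)%E} -> \int[P]_w Y w <= c.
  move=> iY Yg.
  have mY : measurable_fun setT Y by apply/measurable_EFinP; exact: measurable_int iY.
  pose B k := [set w | exists2 p, epigraph (f^~ w) p &
    [/\ `|p.1| < k%:R, `|p.2 : R| < k%:R & p.2 < dot p.1 (u w) + - Y w]].
  have sel k := epigraph_selection nf k%:R mu (measurable_funN mY).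
  have mB k : measurable (B k) by have [] := sel k.
  (* [Z k] dominates f(y) - y.u for the competitor equal to the selection on [B k] and to [x0]
     elsewhere. *)
  pose Z k w := if w \in B k then - Y w else - l w.
  have Zc k : ((- c)%:E <= \int[P]_w (Z k w)%:E)%E.
    have [_ [y [al [my mal] yP]]] := sel k.
    pose yk w := if w \in B k then y w else x0 w.
    have myk : vmeasurable yk by exact: vmeasurable_if.
    have ykM w : `|yk w| <= Num.max k%:R M0.
      rewrite /yk; case: ifPn => [/set_mem/yP[_ /ltW h _ _]|_].
        by rewrite le_max h.
      by rewrite le_max x0M orbT.
    have ifk : P.-integrable setT (fun w => f (yk w) w).
      apply: (@bounded_integrand_integrable _ _ (Num.max k%:R M0)) => //.
      have ik : P.-integrable setT (EFin \o (cst k%:R : T -> R)).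
        by apply: (@bounded_integrable _ _ _ _ _ _ k%:R) => // w _; rewrite normr_nat.
      have := integrableD measurableT ik (integrable_funepos measurableT fx0).
      apply: le_integrable => //; first exact/measurable_funepos/mfx.
      move=> w _ /=; rewrite [leRHS]gee0_abs ?adde_ge0// gee0_abs//.
      rewrite !funeposE ge_max adde_ge0 ?le_max ?lexx ?orbT// andbT /yk.
      case: ifPn => [/set_mem/yP[h _ /ltW al1 _]|_].
        apply: le_trans h _; rewrite -[leLHS]adde0 leeD//.
          by rewrite lee_fin (le_trans (ler_norm _) al1).
        by rewrite le_max lexx orbT.
      by rewrite -[leLHS]add0e leeD// le_max lexx.
    have idk := idot _ _ myk ykM.
    have iZ : P.-integrable setT (EFin \o Z k).
      have := integrableD measurableT (integrable_abse iY) (integrable_abse il).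
      apply: le_integrable => //.
        by apply/measurable_EFinP/measurable_fun_in_ifT => //; exact: measurable_funN.
      move=> w _ /=; rewrite lee_fin /Z; case: ifP => _.
        by rewrite normrN [leRHS]ger0_norm ?addr_ge0// lerDl.
      by rewrite normrN [leRHS]ger0_norm ?addr_ge0// lerDr.
    rewrite EFin_Rintegral// lee_fin; apply: le_trans (hc yk _ myk ykM ifk) _.
    apply: ae_le_Rintegral => //.
      have := integrableB measurableT (integrable_fine measurableT ifk) idk.
      exact: eq_integrable.
    have := ae_fineK measurableT ifk; apply: filterS => w /(_ Logic.I) fin _.
    rewrite /Z; move: fin; rewrite /yk; case: ifPn => [/set_mem/yP[h _ _ al2] fin|_ _].
      have {h} : fine (f (y w) w) <= al w by rewrite -lee_fin -fin.
      by move: al2 => /=; lra.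
    by rewrite /l; lra.
  (* A witness for [Y w < g w] is a single point, bounded by some integer, so almost every [w]
     belongs to [B k] for all large [k]. *)
  have Zcv : {ae P, forall w, setT w -> (fun k => (Z k w)%:E) @ \oo --> (- Y w)%:E}.
    apply: filterS Yg => w /conjugate_gtP[p pf pY] _.
    apply: cvg_near_cst.
    pose N := (Num.truncn (Num.max `|p.1| `|p.2 : R|)).+1.
    exists N => // k /= Nk; rewrite /Z mem_set//; exists p => //.
    have := truncnS_gt (Num.max `|p.1| `|p.2 : R|); rewrite gt_max => /andP[p1 p2].
    have Nk' : N%:R <= k%:R :> R by rewrite ler_nat.
    by split; [exact: lt_le_trans Nk'|exact: lt_le_trans Nk'|lra].
  have iG := integrableD measurableT (integrable_abse iY) (integrable_abse il).
  have mZ k : measurable_fun setT (EFin \o Z k).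
    by apply/measurable_EFinP/measurable_fun_in_ifT => //; exact: measurable_funN.
  have mNY : measurable_fun setT (EFin \o (fun w => - Y w)).
    exact/measurable_EFinP/measurable_funN.
  have bZ : {ae P, forall w k, setT w -> (`|(EFin \o Z k) w| <=
      ((abse \o (EFin \o Y)) \+ (abse \o (EFin \o l))) w)%E}.
    apply: aeW => w k _; rewrite /= lee_fin /Z; case: ifP => _; rewrite normrN.
      by rewrite lerDl.
    by rewrite lerDr.
  have [_ _ cv] := @dominated_convergence _ _ _ P setT measurableT
    (fun k => EFin \o Z k) _ _ mZ mNY Zcv iG bZ.
  have iNY : P.-integrable setT (EFin \o (fun w => - Y w)).
    exact: (integrableN iY).
  have cY : ((- c)%:E <= \int[P]_w (- Y w)%:E)%E.
    by apply: (cvge_to_ge cv); exact: nearW.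
  rewrite -lerN2 -[leRHS]mulN1r -RintegralZl//.
  under eq_Rintegral do rewrite mulN1r.
  by rewrite -lee_fin -EFin_Rintegral.
have step2 (Y : T -> R) : P.-integrable setT (EFin \o Y) ->
    {ae P, forall w, ((Y w)%:E <= g w)%E} -> \int[P]_w Y w <= c.
  move=> iY Yg; apply/ler_addgt0Pr => e e0.
  have ie : P.-integrable setT (EFin \o (cst e : T -> R)).
    by apply: (@bounded_integrable _ _ _ _ _ _ e) => // w _; rewrite /= ger0_norm ?(ltW e0).
  rewrite -lerBlDr.
  have -> : \int[P]_w Y w - e = \int[P]_w (Y w - e).
    rewrite RintegralB// Rintegral_cst//.
    by rewrite [fine _](congr1 fine (probability_setT P)) mulr1.
  apply: step1.
    by have := integrableB measurableT iY ie; exact: eq_integrable.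
  apply: filterS Yg => w; apply: lt_le_trans.
  by rewrite lte_fin ltrBlDr ltrDl.
have lg : {ae P, forall w, ((l w)%:E <= g w)%E}.
  have := ae_fineK measurableT fx0; apply: filterS => w /(_ Logic.I) fin.
  have := @fenchel _ _ (f^~ w) (x0 w) (u w); rewrite fin => /(_ isT).
  by rewrite -leeBlDl.
(* Almost everywhere this is [g - l]; the maximum with 0 makes it nonnegative everywhere. Its
   truncations are bounded, so that adding [l] gives integrable functions below [g] to which [step2]
   applies. *)
pose X w := (maxe (g w - (l w)%:E) 0)%E.
have mX : measurable_fun setT X.
  apply: measurable_maxe => //; apply: emeasurable_funB => //.
  exact/measurable_EFinP.
have X0 w : (0 <= X w)%E by rewrite le_max lexx orbT.
pose Xk (k : nat) w := mine (X w) k%:R%:E.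
have mXk k : measurable_fun setT (Xk k) by exact: measurable_mine.
have Xk0 k w : (0 <= Xk k w)%E by rewrite le_min X0 /= lee_fin ler0n.
have Xkk k w : (Xk k w <= k%:R%:E)%E by rewrite ge_min lexx orbT.
have Xkf k w : Xk k w \is a fin_num.
  by rewrite ge0_fin_numE ?Xk0// (le_lt_trans (Xkk k w))// ltry.
have XE w : ((l w)%:E <= g w)%E -> X w = (g w - (l w)%:E)%E.
  by move=> h; rewrite /X max_l// sube_ge0.
have iXk k : P.-integrable setT (EFin \o (fun w => fine (Xk k w))).
  apply: (@bounded_integrable _ _ _ _ _ _ k%:R) => //.
    exact: measurableT_comp.
  move=> w _; rewrite ger0_norm ?fine_ge0//.
  by rewrite -lee_fin fineK.
have Xkc k : (\int[P]_w Xk k w <= (c - \int[P]_w l w)%:E)%E.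
  under eq_integral do rewrite -(fineK (Xkf k _)).
  rewrite EFin_Rintegral// lee_fin lerBrDr -RintegralD//.
  apply: step2.
    by have := integrableD measurableT (iXk k) il; exact: eq_integrable.
  apply: filterS lg => w lgw; rewrite EFinD fineK// -leeBrDr//.
  by rewrite -XE// /Xk ge_min lexx.
have Xc : (\int[P]_w X w <= (c - \int[P]_w l w)%:E)%E.
  have := @cvg_monotone_convergence _ _ _ P setT measurableT Xk mXk.
  move=> /(_ (fun k w _ => Xk0 k w)) cv.
  have XkX w : limn (Xk ^~ w) = X w.
    apply/cvg_lim => //; rewrite /Xk.
    have := X0 w; case: (X w) => [r| |]//= r0.
      apply: cvg_near_cst; exists (Num.truncn r).+1 => // k /= kr.
      rewrite min_l// lee_fin ltW//; apply: lt_le_trans (truncnS_gt _) _.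
      by rewrite ler_nat.
    under eq_fun do rewrite min_r ?leey//.
    by apply/cvgeryP; exact: cvgr_idn.
  have {cv} cv : (fun k => \int[P]_w Xk k w)%E @ \oo --> (\int[P]_w X w)%E.
    under [X in _ --> X]eq_integral do rewrite -XkX.
    apply: cv => w _ i j ij; rewrite /Xk le_min ge_min lexx /=.
    by rewrite ge_min lee_fin ler_nat ij orbT.
  by apply: (cvge_to_le cv); exact: nearW.
have iX : P.-integrable setT X.
  apply: fin_num_integrable => //; rewrite ge0_fin_numE ?integral_ge0//.
  exact: le_lt_trans Xc (ltry _).
have gE : {ae P, forall w, setT w -> (X \+ (EFin \o l)) w = g w}.
  apply: filterS lg => w lgw _ /=; rewrite XE// subeK//.
have iXl := integrableD measurableT iX il.
split; first exact: ae_eq_integrable gE iXl.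
rewrite -(ae_eq_integral g _ measurableT (measurable_int _ iXl) mg gE).
rewrite integralD// -leeBrDr//; first by rewrite (EFin_Rintegral measurableT il).
by rewrite (EFin_Rintegral measurableT il).
Qed.

End Integrand.

(** * Closed-valued mappings compared through integrable selections *)

Section Selections.
Context d (T : measurableType d) (R : realType) (P : probability T R) (n : nat).
Variable G : set_system T.
Hypothesis hG : is_sub_sigma_algebra G.
Local Notation TG := (g_sigma_algebraType G).
Implicit Types (D C : T -> set 'rV[R]_n).

Lemma set_measurable_sub D : set_measurable G D ->
  set_measurable (@measurable _ TG) (D : TG -> set 'rV[R]_n).
Proof. by move=> mD O oO; rewrite (sub_measurableE hG); exact: mD. Qed.

(** Were the inclusion to fail on a set of positive measure, then, on another such set, [D] would
    hit and [C] would miss one ball of a countable family. A selection of [D] in that ball, pasted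
    with [u0] elsewhere, is integrable and cannot be a selection of [C]. *)
Lemma selections_subset D C (u0 : T -> 'rV[R]_n) :
  (forall w, closed (D w)) -> (forall w, closed (C w)) ->
  set_measurable G D -> set_measurable G C ->
  Lp_sel P G 1%E D u0 -> Lp_sel P G 1%E D `<=` Lp_sel P G 1%E C ->
  {ae P, forall w, D w `<=` C w}.
Proof.
move=> cD cC mD mC [Lu0 Du0] DC.
have [q qP] := @rV_separable R n.
have mDG := set_measurable_sub mD; have mCG := set_measurable_sub mC.
pose r (j : nat) : R := j.+1%:R^-1.
have r0 j : 0 < r j by rewrite invr_gt0.
pose hit (S : T -> set 'rV[R]_n) i j := [set w | exists2 p, S w p & 0 < r j - `|p - q i|].
have sel S i j : (forall w, closed (S w)) ->
    set_measurable (@measurable _ TG) (S : TG -> set 'rV[R]_n) ->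
    measurable (hit S i j : set TG) /\ exists2 s : TG -> 'rV[R]_n, vmeasurable s &
      forall w, hit S i j w -> S w (s w) /\ `|s w - q i| < r j.
  move=> cS mS.
  have [|p|mH [s ms sP]] := caratheodory_selection qP (@rV_complete R n) cS mS
    (g := fun _ p => r j - `|p - q i|).
  - by move=> w; exact: continuous_radius_dist.
  - exact: measurable_cst.
  split=> //; exists s => [k|w /sP[? ?]]; last by rewrite -subr_gt0.
  exact: (ms _ (@coord_continuous R 1 n 0 k)).
pose A i j := hit D i j `\` hit C i j.
have mA i j : measurable (A i j : set TG).
  by apply: measurableD; [case: (sel D i j)|case: (sel C i j)].
have null i j : {ae P, forall w, ~ A i j w}.
  have [_ [s ms sP]] := sel D i j cD mDG.
  pose v w := if w \in A i j then s w else u0 w.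
  have mv : vmeasurable (v : TG -> 'rV[R]_n).
    by apply: vmeasurable_if => //; apply/(L0P hG); case: Lu0.
  have mvT : vmeasurable v.
    by apply: (L0_vmeasurable hG); exact/(L0P hG).
  have Lv : Lp P G 1%E v.
    apply/(Lp1P P hG); split=> [|k]; first exact/(L0P hG).
    have [_ iu0] := (Lp1P P hG u0).1 Lu0.
    have ic : P.-integrable setT (EFin \o (cst (`|q i| + r j) : T -> R)).
      apply: (@bounded_integrable _ _ _ _ _ _ (`|q i| + r j)) => // w _.
      by rewrite /= ger0_norm// addr_ge0// ltW.
    have := integrableD measurableT ic (integrable_abse (iu0 k)).
    apply: le_integrable => //; first exact/measurable_EFinP.
    move=> w _ /=; rewrite lee_fin [leRHS]ger0_norm ?addr_ge0//; last exact: ltW.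
    rewrite /v; case: ifPn => [/set_mem[/sP[_ sq] _]|_].
      rewrite ler_wpDr//; apply: le_trans (ler_coord_norm _ _) _.
      rewrite -[s w](subrK (q i)) addrC; apply: le_trans (ler_normD _ _) _.
      by rewrite lerD2l ltW.
    by rewrite lerDr addr_ge0// ltW.
  have /DC[_ Cv] : Lp_sel P G 1%E D v.
    split=> //; apply: filterS Du0 => w Dw; rewrite /v.
    by case: ifPn => [/set_mem[/sP[]]|].
  apply: filterS Cv => w Cw Aw; have [Dh Ch] := Aw; apply: Ch.
  move: Cw; rewrite /v mem_set// => Cw; exists (s w) => //.
  by rewrite subr_gt0; have [] := sP w Dh.
have := ae_foralln (fun i => ae_foralln (null i)).
apply: filterS => w noA p Dp; apply: contrapT => nCp.
(* [C w] is closed, so a point of [D w] outside it has a neighbourhood missing [C w], and this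
   contains a ball of the family around that point. *)
have : nbhs p (~` C w) by apply: open_nbhs_nbhs; split => //; exact: closed_openC.
move=> /nbhs_ballP[e /= e0 eC].
have e20 : 0 < e / 2 by rewrite divr_gt0.
have [j _ /(_ j (leqnn _)) /= je] := near_infty_natSinv_lt (PosNum e20).
have [i pi] := qP p _ (r0 j).
apply: (noA i j); split; first by exists p => //; rewrite subr_gt0.
move=> [p' Cp' p'i]; apply: (eC p') => //; rewrite -ball_normE /=.
apply: le_lt_trans (ler_distD (q i) _ _) _.
rewrite (distrC (q i)) (splitr e); move: p'i; rewrite subr_gt0 => p'i.
by apply: ltrD; [exact: lt_trans je|exact: lt_trans je].
Qed.

End Selections.

(** * Subdifferentials and their measurability *)

Section Subdifferential.
Context (R : realType) (n : nat).
Implicit Types (phi : 'rV[R]_n -> \bar R) (x v p q : 'rV[R]_n).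

(** Subgradients as slopes of affine minorants with a real intercept, the shape shared by
    [conjugate_le] and [condexp_integrand_ge]. *)
Lemma subdiffP phi x v : subdiff phi x v <->
  phi x \is a fin_num /\
  forall p, ((dot p v + (fine (phi x) - dot x v))%:E <= phi p)%E.
Proof.
split=> -[fx h]; split=> // p.
  have := h p; rewrite -{1}(fineK fx) -EFinD dotC dotBl.
  by rewrite (_ : _ + (_ - _) = dot p v + (fine (phi x) - dot x v))//; ring.
have := h p; rewrite -{2}(fineK fx) -EFinD (dotC v) dotBl.
by rewrite (_ : _ + (_ - _) = fine (phi x) + (dot p v - dot x v))//; ring.
Qed.

Lemma subdiff_conjugateP phi x v : phi x \is a fin_num ->
  subdiff phi x v <-> (conjugate phi v <= (dot x v - fine (phi x))%:E)%E.
Proof.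
move=> fx; split=> [/subdiffP[_ h]|h].
  by apply: le_conjugate => p; rewrite opprB.
by apply/subdiffP; split=> // p; have := conjugate_le p h; rewrite opprB.
Qed.

Lemma closed_subdiff phi x : closed (subdiff phi x).
Proof.
have [fx|nfx] := boolP (phi x \is a fin_num); last first.
  rewrite (_ : subdiff phi x = set0); first exact: closed0.
  by apply/seteqP; split=> v // -[fx]; rewrite fx in nfx.
rewrite (_ : subdiff phi x = \bigcap_p
    [set v | ((dot p v + (fine (phi x) - dot x v))%:E <= phi p)%E]); last first.
  apply/seteqP; split=> v; first by move=> /subdiffP[_ h] p _; exact: h.
  by move=> h; apply/subdiffP; split=> // p; exact: h.
apply: closed_bigI => p _; case: (phi p) => [r| |].
- rewrite (_ : [set _ | _] =
      (fun v => dot v (p - x)) @^-1` [set t | t <= r - fine (phi x)]).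
    apply: closed_comp; last exact: closed_le.
    by move=> v _; exact: dot_continuous.
  apply/seteqP; split=> v /=; rewrite lee_fin dotBr !(dotC _ v); lra.
- rewrite (_ : [set _ | _] = setT); first exact: closedT.
  by apply/seteqP; split=> v //= _; exact: leey.
- rewrite (_ : [set _ | _] = set0); first exact: closed0.
  by apply/seteqP; split.
Qed.

End Subdifferential.

Section SubdifferentialMeasurable.
Context d (T : measurableType d) (R : realType) (n : nat).
Variable h : 'rV[R]_n -> T -> \bar R.
Hypothesis nh : normal_integrand (@measurable d T) h.
Variable x : T -> 'rV[R]_n.
Hypothesis mx : vmeasurable x.

Let b w := fine (h (x w) w).
(** The excess at [p.1] of the affine function of slope [v] through the graph at [x w], over the
    height [p.2]. *)
Let gap w (p : 'rV[R]_n * R^o) v : R := dot (p.1 - x w) v + b w - p.2.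

Let subdiff_gap w v : h (x w) w \is a fin_num ->
  subdiff (h^~ w) (x w) v <-> forall p, epigraph (h^~ w) p -> gap w p v <= 0.
Proof.
move=> fx; split=> [/subdiffP[_ sd] [p a] /= pa|sd].
  have := le_trans (sd p) pa.
  by rewrite /gap /= lee_fin dotBl -/(b w); lra.
apply/subdiffP; split=> // p; rewrite -/(b w).
case hp : (h p w) => [r| |]; last 2 first.
- exact: leey.
(* At a value [-oo] a height one unit below the affine function has gap 1, contrary to the
   hypothesis. *)
- pose t : R^o := dot p v + (b w - dot (x w) v) - 1.
  have pe : epigraph (h^~ w) (p, t) by rewrite /epigraph /= hp leNye.
  by exfalso; have := sd _ pe; rewrite /gap /t /= dotBl; lra.
- have pe : epigraph (h^~ w) (p, r : R^o) by rewrite /epigraph /= hp.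
  by have := sd _ pe; rewrite /gap /= dotBl lee_fin; lra.
Qed.

Variable q : nat -> 'rV[R]_n.
Hypothesis q_dense : forall p (e : R), 0 < e -> exists k, `|p - q k| < e.

Let r (m : nat) : R := m.+1%:R^-1.
Let r0 m : 0 < r m. Proof. by rewrite invr_gt0. Qed.

(** Failure of [q k] to be a subgradient up to the tolerance [r m]. Bounding [p.1] by [m.+1%:R]
    makes this condition stable: a dense point close enough to a true subgradient is not far. *)
Let far m k := [set w | exists2 p, epigraph (h^~ w) p &
  0 < Num.min (m.+1%:R - `|p.1|) (gap w p (q k) - r m)].

Let measurable_far m k : measurable (far m k).
Proof.
apply: (normal_integrand_selection nh _ _).1 => [w p|p].
  apply: (@continuous_min _ _ (fun p : 'rV[R]_n * R^o => m.+1%:R - `|p.1|)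
    (fun p : 'rV[R]_n * R^o => gap w p (q k) - r m)).
    apply: cvgB; first exact: cvg_cst.
    have cf : fst @ p --> p.1 by exact: cvg_fst.
    exact: (cvg_norm cf).
  apply: cvgB; last exact: cvg_cst.
  apply: cvgB; last exact: cvg_snd.
  apply: cvgD; last exact: cvg_cst.
  rewrite dotBl; under eq_fun do rewrite dotBl.
  apply: cvgB; last exact: cvg_cst.
  apply: (@continuous_comp _ _ _ fst (fun z : 'rV[R]_n => dot z (q k))).
    exact: cvg_fst.
  exact: dot_continuous.
apply: measurable_minr; first exact: measurable_cst.
apply: measurable_funB; last exact: measurable_cst.
apply: measurable_funB; last exact: measurable_cst.
apply: measurable_funD.
  apply: measurable_dot; last exact: vmeasurable_cst.
  by apply: vmeasurableB => //; exact: vmeasurable_cst.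
by apply: measurableT_comp => //; exact: measurable_normal_integrand.
Qed.

(** A countable description of the event that the subdifferential meets the closed ball of radius
    [r j] around [q i]; the extra [r m] leaves room for approximation by dense points. *)
Let hits i j := \bigcap_m \bigcup_(k in [set k | `|q k - q i| < r j + r m])
  ~` far m k.

Let measurable_hits i j : measurable (hits i j).
Proof.
apply: bigcapT_measurable => m; apply: bigcup_measurable => k _.
exact: measurableC.
Qed.

(* Compactness of the closed ball turns the approximate subgradients picked
   from the dense sequence into a subgradient. *)
Let hitsP i j w : h (x w) w \is a fin_num ->
  hits i j w <-> exists2 v, subdiff (h^~ w) (x w) v & `|v - q i| <= r j.
Proof.
move=> fx; split=> [hw|[v /(subdiff_gap _ fx) sd vi] m _]; last first.
  (* The factor [n%:R] comes from [ler_norm_dot] for the sup norm; the 1 keeps the divisor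
     positive. *)
  pose C := n%:R * (m.+1%:R + `|x w|) + 1.
  have C0 : 0 < C by rewrite ltr_wpDl// mulr_ge0// addr_ge0.
  have e0 : 0 < Num.min (r m) (r m / C) by rewrite lt_min r0 divr_gt0.
  have [k] := q_dense v e0; rewrite lt_min => /andP[k1 k2].
  exists k => /=.
    apply: le_lt_trans (ler_distD v _ _) _; rewrite (distrC _ v) addrC.
    exact: ler_ltD.
  move=> [p pe]; rewrite lt_min !subr_gt0 => /andP[p1 p2].
  have : gap w p (q k) = gap w p v + dot (p.1 - x w) (q k - v).
    by rewrite /gap dotBr; lra.
  have := sd p pe; have := ler_norm (dot (p.1 - x w) (q k - v)).
  have : `|dot (p.1 - x w) (q k - v)| <= r m; last by lra.
  apply: le_trans (ler_norm_dot _ _) _.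
  have pC : n%:R * `|p.1 - x w| <= C.
    rewrite ler_wpDr// ler_wpM2l//; apply: le_trans (ler_normB _ _) _.
    by rewrite lerD2r ltW.
  rewrite mulrA; apply: le_trans (ler_wpM2r (normr_ge0 _) pC) _.
  by rewrite mulrC -ler_pdivlMr// distrC ltW.
have /choice[k kP] : forall m, exists k, `|q k - q i| < r j + r m /\ ~ far m k w.
  by move=> m; have [k ? ?] := hw m Logic.I; exists k.
have rle (m : nat) : r m <= 1 by rewrite invf_le1 ?ler1n.
(* Radius 2 suffices, since both [r j] and [r m] are at most 1. *)
have cK : compact (closed_ball_ Num.norm (q i) (2 : R)).
  apply: bounded_closed_compact; last exact: closed_closed_ball_.
  exists (`|q i| + 2); split; first exact: num_real.
  move=> M qM v /= vi; apply: le_trans (ltW qM).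
  rewrite -[v](subrK (q i)) addrC; apply: le_trans (ler_normD _ _) _.
  by rewrite lerD2l distrC.
have [|v [_ vcl]] := cK (q \o k @ \oo).
  exists 0%N => // m _; rewrite /closed_ball_ /= distrC.
  by have := (kP m).1; have := rle m; have := rle j; lra.
(* The cluster point is approached along indices that can be taken beyond any [M], so that the
   tolerance and the bound on [p.1] improve together. *)
have approx e M : 0 < e -> exists m, [/\ (M <= m)%N, r m < e & `|v - q (k m)| < e].
  move=> e0.
  have [N _ NP] := near_infty_natSinv_lt (PosNum e0).
  have nv : nbhs v (ball v e) by exact: nbhsx_ballx.
  have tail : (q \o k @ \oo) ((q \o k) @` [set m | (maxn M N <= m)%N]).
    by exists (maxn M N) => // m /= mM; exists m.
  have [_ [[m mM <-] vm]] := vcl _ _ tail nv.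
  move: mM => /=; rewrite geq_max => /andP[Mm Nm].
  exists m; split=> //; first exact: NP.
  by move: vm; rewrite -ball_normE.
exists v; last first.
  apply/ler_addgt0Pr => e e0; have e20 : 0 < e / 2 by rewrite divr_gt0.
  have [m [_ rm vm]] := approx _ 0%N e20; have := (kP m).1.
  have := ler_distD (q (k m)) v (q i).
  lra.
apply/(subdiff_gap _ fx) => p pe; rewrite leNgt; apply/negP => g0.
pose C := n%:R * `|p.1 - x w| + 1.
have C0 : 0 < C by rewrite ltr_wpDl// mulr_ge0.
(* Half of the gap pays for the move from [v] to [q (k m)]; the remaining half exceeds [r m]. *)
have e0 : 0 < Num.min (gap w p v / 2) (gap w p v / 2 / C) by rewrite lt_min !divr_gt0.
have [m [Mm]] := approx _ (Num.truncn `|p.1|) e0.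
rewrite !lt_min => /andP[m1 _] /andP[_ m2].
apply: (kP m).2; exists p => //; rewrite lt_min !subr_gt0; apply/andP; split.
  by apply: lt_le_trans (truncnS_gt _) _; rewrite ler_nat.
have : gap w p (q (k m)) = gap w p v - dot (p.1 - x w) (v - q (k m)).
  by rewrite /gap dotBr; lra.
have := ler_norm (dot (p.1 - x w) (v - q (k m))).
have : `|dot (p.1 - x w) (v - q (k m))| <= gap w p v / 2; last by lra.
apply: le_trans (ler_norm_dot _ _) _; rewrite mulrA.
have pC : n%:R * `|p.1 - x w| <= C by rewrite lerDl.
apply: le_trans (ler_wpM2r (normr_ge0 _) pC) _.
by rewrite mulrC -ler_pdivlMr// ltW.
Qed.

Lemma subdiff_set_measurable_dense :
  set_measurable (@measurable d T) (fun w => subdiff (h^~ w) (x w)).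
Proof.
move=> O oO.
rewrite (_ : [set w | _] = (setT `&` [set w | h (x w) w \is a fin_num]) `&`
    \bigcup_i \bigcup_(j in [set j | closed_ball_ Num.norm (q i) (r j) `<=` O]) hits i j).
  apply: measurableI.
    by apply: emeasurable_fin_num => //; exact: measurable_normal_integrand.
  apply: bigcupT_measurable => i; apply: bigcup_measurable => j _.
  exact: measurable_hits.
apply/seteqP; split=> w.
  move=> [v [sd Ov]]; have [fx _] := sd; split => //.
  have /nbhs_ballP[e /= e0 eO] : nbhs v O by exact: open_nbhs_nbhs.
  have e20 : 0 < e / 2 by rewrite divr_gt0.
  have [j _ /(_ j (leqnn _)) /= je] := near_infty_natSinv_lt (PosNum e20).
  have [i vi] := q_dense v (r0 j).
  exists i => //; exists j; last by apply/(hitsP _ _ fx); exists v => //; exact: ltW.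
  move=> z /= zi; apply: eO; rewrite -ball_normE /=.
  apply: le_lt_trans (ler_distD (q i) _ _) _.
  by rewrite (splitr e) ltr_leD ?(lt_trans vi)// (le_trans zi)// ltW.
move=> [[_ fx] [i _ [j jO]]] /(hitsP _ _ fx)[v sd vi].
by exists v; split => //; apply: jO; rewrite /closed_ball_ /= distrC.
Qed.

End SubdifferentialMeasurable.

Lemma subdiff_set_measurable d (T : measurableType d) (R : realType) n
    (h : 'rV[R]_n -> T -> \bar R) (x : T -> 'rV[R]_n) :
  normal_integrand (@measurable d T) h -> vmeasurable x ->
  set_measurable (@measurable d T) (fun w => subdiff (h^~ w) (x w)).
Proof.
move=> nh mx; have [q qP] := @rV_separable R n.
exact: subdiff_set_measurable_dense qP.
Qed.

(** * Conditional expectations of integrands and of their conjugates *)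

Section ConditionalIntegrand.
Context d (T : measurableType d) (R : realType) (P : probability T R) (n : nat).
Variables (G : set_system T) (f h : 'rV[R]_n -> T -> \bar R).
Hypothesis hG : is_sub_sigma_algebra G.
Hypothesis nf : normal_integrand (@measurable d T) f.
Hypothesis fh : is_condexp_integrand P G f h.
Implicit Types (A : set T) (x y a u v : T -> 'rV[R]_n).
Local Notation F := (@measurable d T).
Local Notation TG := (g_sigma_algebraType G).

Variables v0 x0 : T -> 'rV[R]_n.
Variable M0 : R.
Hypothesis Lv0 : Lp P F 1%E v0.
Hypothesis Efv0 : (Eint P (fun p w => conjugate (f^~ w) p) v0 < +oo)%E.
Hypothesis Lx0 : L0 G x0.
Hypothesis x0M : forall w, `|x0 w| <= M0.
Hypothesis fx0 : P.-integrable setT (fun w => f (x0 w) w).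

Let GT A : G A -> measurable A := @hG.2 A.
Let hF := measurable_sub_sigma_algebra T.

(** Over a set of [G] both integrals agree, and a finite integral already means integrability. Thus
    [X] may be integrable on [A] only. *)
Lemma condexp_integrable (X Y : T -> \bar R) A : G A -> is_condexp P G X Y ->
  P.-integrable A X -> P.-integrable A Y.
Proof.
move=> GA [_ _ sY XY] iX; apply: fin_num_integrable; first exact: GT.
  apply: measurable_funTS; apply: (sub_measurable_measurable hG).
  exact/(sub_measurableP hG).
by rewrite -XY//; apply: integrable_fin_num => //; exact: GT.
Qed.

Lemma bounded_is_condexp y (M : R) : L0 G y -> (forall w, `|y w| <= M) ->
  is_condexp P G (fun w => f (y w) w) (fun w => h (y w) w).
Proof.
move=> Ly yM; apply: fh.2 => //; right.
by apply: (negpart_integrable nf Lv0 Efv0 _ (L0_vmeasurable hG Ly)) => // w _.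
Qed.

(* If the inequality failed on a set of positive measure, a measurable selection
   of the epigraph of [h] strictly below the affine function would contradict
   the hypothesis; [rho] localizes to sets where everything is bounded. *)
Lemma condexp_integrand_ge a (b rho : T -> R) : L0 G a -> sub_measurable G b ->
  sub_measurable G rho ->
  (forall y A (N : R), L0 G y -> (forall w, `|y w| <= N) -> G A ->
    (forall w, A w -> [/\ `|a w| <= N, `|b w| <= N & rho w <= N]) ->
    (\int[P]_(w in A) (dot (y w) (a w) + b w)%:E <=
     \int[P]_(w in A) f (y w) w)%E) ->
  {ae P, forall w, forall p, ((dot p (a w) + b w)%:E <= h p w)%E}.
Proof.
move=> La sb srho hyp.
have nh := normal_integrand_sub hG fh.1.
have ma := (L0P hG a).1 La.
have mb := (sub_measurableP hG b).1 sb.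
pose B (N : nat) := [set w | [/\ `|a w| < N%:R, `|b w| < N%:R & rho w < N%:R]] `&`
  [set w | exists2 p, epigraph (h^~ w) p &
    [/\ `|p.1| < N%:R, `|p.2 : R| < N%:R & p.2 < dot p.1 (a w) + b w]].
have sel (N : nat) := epigraph_selection nh N%:R ma mb.
have GB N : G (B N).
  rewrite -(sub_measurableE hG); apply: measurableI; last by have [] := sel N.
  rewrite (_ : [set w | _] = (fun w => `|a w|) @^-1` `]-oo, N%:R[%classic `&`
     ((fun w => `|b w|) @^-1` `]-oo, N%:R[%classic `&`
      rho @^-1` `]-oo, N%:R[%classic)); last first.
    apply/seteqP; split=> w /=; rewrite !in_itv /=; first by case.
    by move=> [? []].
  apply: measurableI; [|apply: measurableI];
    rewrite -[X in measurable X]setTI.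
  - exact: (measurable_rV_norm ma).
  - have : measurable_fun [set: TG] (fun w => `|b w|) by exact: measurableT_comp.
    by apply.
  - exact: ((sub_measurableP hG rho).1 srho).
have null N : {ae P, forall w, ~ B N w}.
  have [_ [z [al [mz mal] zP]]] := sel N.
  have mB := GT (GB N).
  pose y w := if w \in B N then z w else 0.
  have Ly : L0 G y.
    by apply/(L0P hG)/vmeasurable_if => //; rewrite (sub_measurableE hG).
  have zB w : B N w -> [/\ (h (z w) w <= (al w)%:E)%E, `|z w| < N%:R,
      `|al w| < N%:R & al w < dot (z w) (a w) + b w] by move=> [_ /zP].
  have yM w : `|y w| <= N%:R.
    by rewrite /y; case: ifPn => [/set_mem/zB[_ /ltW]|_] //; rewrite normr0.
  have [_ _ sy yE] := bounded_is_condexp Ly yM.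
  have my := L0_vmeasurable hG Ly.
  have ma' := L0_vmeasurable hG La.
  have yB w : B N w -> [/\ (h (y w) w <= (al w)%:E)%E, `|y w| < N%:R,
      `|al w| < N%:R & al w < dot (y w) (a w) + b w].
    by move=> Bw; rewrite /y mem_set//; exact: zB.
  pose D w := dot (y w) (a w) + b w.
  have mD : measurable_fun setT D.
    apply: measurable_funD; first exact: measurable_dot.
    exact: (sub_measurable_measurable hG mb).
  have mal' := sub_measurable_measurable hG mal.
  have iD : P.-integrable (B N) (EFin \o D).
    apply: (@bounded_integrable _ _ _ _ _ _ (n%:R * (N%:R * N%:R) + N%:R)) => //.
      exact: measurable_funTS.
    move=> w Bw; have [_ /ltW yN _ _] := yB w Bw.
    have [[/ltW aN /ltW bN _] _] := Bw.
    apply: le_trans (ler_normD _ _) _; apply: lerD => //.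
    apply: le_trans (ler_norm_dot _ _) _; rewrite ler_wpM2l// ler_pM//.
  have ial : P.-integrable (B N) (EFin \o al).
    apply: (@bounded_integrable _ _ _ _ _ _ N%:R) => //.
      exact: measurable_funTS.
    by move=> w /yB[_ _ /ltW].
  (* The hypothesis and conditioning bound the integral of [D] by that of h(y), hence by that of
     [al], although [al < D] on [B N]. *)
  have Dal : \int[P]_(w in B N) (D w - al w) <= 0.
    rewrite RintegralB// subr_le0 -lee_fin -!EFin_Rintegral//.
    apply: le_trans (hyp y (B N) _ Ly yM (GB N) _) _ => [w [[aN bN rN] _]|].
      by split; exact: ltW.
    rewrite yE; last exact: GB.
    apply: (ae_le_integral mB _ (measurable_int _ ial)).
      apply: measurable_funTS; apply: (sub_measurable_measurable hG).
      exact/(sub_measurableP hG).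
    by apply: aeW => w /yB[].
  have iDal : P.-integrable (B N) (EFin \o (fun w => D w - al w)).
    exact: (integrableB mB iD ial).
  have : {ae P, forall w, B N w -> D w - al w = 0}.
    apply: (ge0_Rintegral_le0 mB iDal _ Dal).
    by apply: aeW => w /yB[_ _ _ /ltW]; rewrite subr_ge0.
  move=> D0; apply: filterS D0 => w D0 Bw; have [_ _ _] := yB w Bw.
  by rewrite -subr_gt0 -/(D w) D0// ltxx.
apply: filterS (ae_foralln null) => w noB p.
rewrite leNgt; apply/negP => hp.
have [alpha h1 h2] : exists2 alpha : R, (h p w <= alpha%:E)%E &
    alpha < dot p (a w) + b w.
  case hpw : (h p w) hp => [r| |]//= hp; first by exists r.
  exists (dot p (a w) + b w - 1); first exact: leNye.
  by rewrite ltrBlDr ltrDl.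
pose m := `|a w| + `|b w| + `|rho w| + `|p| + `|alpha|.
have mS := truncnS_gt m.
have := ler_norm (rho w).
have := (normr_ge0 (a w), normr_ge0 (b w), normr_ge0 (rho w)).
have := (normr_ge0 p, normr_ge0 alpha).
move=> [p0 al0] [[a0' b0] r0] rr.
apply: (noB (Num.truncn m).+1); move: mS; rewrite {1}/m => mS.
split; first by split; lra.
by exists (p, alpha : R^o) => //; split => //=; lra.
Qed.

Lemma sub_setT : G setT.
Proof. by rewrite -(sub_measurableE hG). Qed.

Lemma L0_sub_L0 x : L0 G x -> L0 F x.
Proof. by move=> Lx j B mB; exact/hG.2/Lx. Qed.

Lemma vmeasurable_L0 x : vmeasurable x -> L0 F x.
Proof. by move=> mx j B mB; rewrite -[X in measurable X]setTI; exact: mx. Qed.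

(** The choice x = 0 in the infimum. *)
Lemma tilde_phi_le xs y : Lp P G 1%E xs -> vmeasurable y ->
  P.-integrable setT (fun w => f (y w) w) ->
  P.-integrable setT (EFin \o (fun w => dot (y w) (xs w))) ->
  (tilde_phi P G f xs y <=
   (\int[P]_w (fine (f (y w) w) - dot (y w) (xs w)))%:E)%E.
Proof.
move=> Lxs my ify idot.
have iX := integrableB measurableT ify idot.
have -> : (\int[P]_w (fine (f (y w) w) - dot (y w) (xs w)))%:E =
    Eext P (fun w => f (y w) w - (dot (y w) (xs w))%:E)%E.
  rewrite /Eext asboolT; last exact: integrable_funepos iX.
  rewrite [RHS](integralB measurableT ify idot) (integral_fine measurableT ify).
  rewrite (EFin_Rintegral measurableT idot) RintegralB//.
  exact: integrable_fine.
apply: ereal_inf_lbound; exists (cst 0).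
  apply: (ae_bounded_Lpoo (M := 0)) => //.
    by apply/(L0P hG); exact: vmeasurable_cst.
  by apply: aeW => w; rewrite /= normr0.
by congr Eext; apply/funext => w; rewrite /= add0r.
Qed.

(** The infimum ranges over a space stable under the translation by [z], so it absorbs [z]. *)
Lemma tilde_phi_shift xs z (M : R) : L0 G z -> (forall w, `|z w| <= M) ->
  (tilde_phi P G f xs z <= tilde_phi P G f xs (cst 0%R))%E.
Proof.
move=> Lz zM; apply: le_ereal_inf => _ [x Lx <-].
exists (fun w => x w - z w); last first.
  by congr Eext; apply/funext => w; rewrite /= subrK addr0.
have [x' [M' [Lx' x'M] xx']] := Lpoo_bounded hG Lx.
apply: (ae_bounded_Lpoo (M := M' + M)) => //.
  by apply/(L0P hG)/vmeasurableB; apply/(L0P hG) => //; case: Lx.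
apply: filterS xx' => w ->; apply: le_trans (ler_normB _ _) _.
by rewrite lerD.
Qed.

(** A finite infimum provides a near minimizer. Its bounded representative makes x.xs integrable, so
    that integrability of the positive part passes to f(x); the negative part is controlled by
    [v0]. *)
Lemma tilde_phi_minimizer xs (r e : R) : Lp P G 1%E xs ->
  tilde_phi P G f xs (cst 0%R) = r%:E -> 0 < e ->
  exists x, exists2 M, L0 G x /\ (forall w, `|x w| <= M) &
    P.-integrable setT (fun w => f (x w) w) /\
    \int[P]_w (fine (f (x w) w) - dot (x w) (xs w)) <= r + e.
Proof.
move=> Lxs phir e0.
have /ereal_inf_lt[_ [x Lx <-]] : (tilde_phi P G f xs (cst 0%R) < (r + e)%:E)%E.
  by rewrite phir lte_fin ltrDl.
set X := (X in Eext P X) => XE.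
have iXp := Eext_lty (lt_trans XE (ltry _)).
have {}XE : (\int[P]_w X w < (r + e)%:E)%E.
  by move: XE; rewrite /Eext asboolT.
have [x' [M' [Lx' x'M] xx']] := Lpoo_bounded hG Lx.
have mx' := L0_vmeasurable hG Lx'.
have mxs := L0_vmeasurable hG Lxs.1.
have mx := L0_vmeasurable hG Lx.1.
have idot : P.-integrable setT (EFin \o (fun w => dot (x' w) (xs w))).
  by apply: (dot_integrable hG _ mx' _ Lxs) => // w _; exact: x'M.
pose X' w := (f (x' w) w - (dot (x' w) (xs w))%:E)%E.
have mf' : measurable_fun setT (fun w => f (x' w) w).
  exact: measurable_normal_integrand.
have mX' : measurable_fun setT X'.
  by apply: emeasurable_funB => //; exact: measurable_int idot.
have XX' : {ae P, forall w, setT w -> X w = X' w}.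
  by apply: filterS xx' => w xw _; rewrite /X /X' /= addr0 xw.
have mxz : vmeasurable (fun w => x w + (cst 0 : T -> 'rV[R]_n) w).
  by apply: vmeasurableD => // j; exact: measurable_cst.
have mX : measurable_fun setT X.
  apply: emeasurable_funB.
    exact: measurable_normal_integrand.
  by apply/measurable_EFinP; exact: measurable_dot.
have iXp' : P.-integrable setT X'^\+%E.
  apply: (ae_eq_integrable measurableT _ _ iXp).
    exact: measurable_funepos.
  by apply: filterS XX' => w /(_ Logic.I) XXw _; rewrite !funeposE XXw.
have ifp : P.-integrable setT (fun w => f (x' w) w)^\+%E.
  have := integrableD measurableT iXp' (integrable_abse idot).
  apply: le_integrable => //; first exact: measurable_funepos.
  move=> w _ /=; rewrite [leRHS]gee0_abs ?adde_ge0// gee0_abs//.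
  rewrite !funeposE /X' ge_max adde_ge0 ?le_max ?lexx ?orbT// andbT.
  case: (f (x' w) w) => [s| |]//=; last by rewrite leNye.
  rewrite -EFinB -EFin_max.
  suff : s <= Num.max (s - dot (x' w) (xs w)) 0 + `|dot (x' w) (xs w)|.
    by rewrite -lee_fin.
  have := ler_norm (dot (x' w) (xs w)).
  have : s - dot (x' w) (xs w) <= Num.max (s - dot (x' w) (xs w)) 0.
    by rewrite le_max lexx.
  lra.
have ifx' : P.-integrable setT (fun w => f (x' w) w).
  by apply: (bounded_integrand_integrable nf Lv0 Efv0 _ mx' _ ifp) => // w _; exact: x'M.
have iX' := integrableB measurableT ifx' idot.
exists x', M' => //; split=> //; rewrite ltW// -lte_fin.
rewrite -EFin_Rintegral//; last first.
  exact: (integrableB measurableT (integrable_fine measurableT ifx') idot).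
apply: le_lt_trans XE.
rewrite [leRHS](ae_eq_integral X')// le_eqVlt; apply/orP; left; apply/eqP.
apply: ae_eq_integral => //.
  apply/measurable_EFinP; apply: measurable_funB.
    exact: measurableT_comp.
  exact: measurable_dot.
have := ae_fineK measurableT ifx'; apply: filterS => w fin Tw /=.
by rewrite /X' [in RHS]fin//.
Qed.

Lemma Lp1D x y : Lp P F 1%E x -> Lp P F 1%E y -> Lp P F 1%E (fun w => x w + y w).
Proof.
move=> Lx Ly; apply/(Lp1P P hF).
have [_ ix] := (Lp1P P hF x).1 Lx; have [_ iy] := (Lp1P P hF y).1 Ly.
split=> [|j].
  by apply/(L0P hF)/vmeasurableD; apply/(L0P hF); [case: Lx|case: Ly].
have := integrableD measurableT (ix j) (iy j).
by apply: eq_integrable => // w _ /=; rewrite mxE.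
Qed.

Lemma Lp1_sub x : Lp P G 1%E x -> Lp P F 1%E x.
Proof. by move=> [Lx fx]; split=> //; exact: L0_sub_L0. Qed.

Lemma Lp1_0 : Lp P G 1%E (cst 0 : T -> 'rV[R]_n).
Proof.
apply/(Lp1P P hG); split=> [|j]; first by apply/(L0P hG); exact: vmeasurable_cst.
apply: (@bounded_integrable _ _ _ _ _ _ 0) => //.
by move=> w _; rewrite /= mxE normr0.
Qed.

(** The value function does not increase along [z] nor along [- z], so the linear term of the
    subgradient inequality vanishes. *)
Lemma subgradient_orthogonal xs v z (M : R) : Lp P F 1%E v ->
  (tilde_phi P G f xs (cst 0%R)) \is a fin_num ->
  (forall z, Lp P F +oo%E z -> (tilde_phi P G f xs (cst 0%R) +
     'E_P[(fun w => dot (z w) (v w))] <= tilde_phi P G f xs z)%E) ->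
  L0 G z -> (forall w, `|z w| <= M) -> \int[P]_w dot (z w) (v w) = 0.
Proof.
move=> Lv phi0 hv.
have le0 y : L0 G y -> (forall w, `|y w| <= M) -> \int[P]_w dot (y w) (v w) <= 0.
  move=> Ly yM.
  have Loo : Lp P F +oo%E y.
    by apply: (ae_bounded_Lpoo (M := M)) => //; [exact: L0_sub_L0|exact: aeW].
  have := le_trans (hv y Loo) (tilde_phi_shift xs Ly yM).
  rewrite unlock EFin_Rintegral//; last first.
    by apply: (dot_integrable hF _ (L0_vmeasurable hG Ly) _ Lv) => // w _; exact: yM.
  by rewrite -(fineK phi0) -EFinD lee_fin; lra.
move=> Lz zM; apply/eqP; rewrite eq_le le0//=.
have LNz : L0 G (fun w => - z w) by apply/(L0P hG)/vmeasurableN/(L0P hG).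
have := le0 _ LNz; under eq_Rintegral do rewrite dotNl -mulN1r.
rewrite RintegralZl//; last first.
  by apply: (dot_integrable hF _ (L0_vmeasurable hG Lz) _ Lv) => // w _; exact: zM.
rewrite mulN1r oppr_le0; apply=> w; by rewrite normrN.
Qed.

(** [Y] is real-valued and the conjugate integrable because the equality case of Fenchel's
    inequality is later integrated over sets where x is bounded. *)
Lemma conjugate_condexp xs : Lp P G 1%E xs ->
  subdifferentiable0 P (tilde_phi P G f xs) ->
  exists v, exists2 Y : T -> R,
    [/\ Lp P F 1%E v, is_condexp_vec P G v (cst 0) &
      P.-integrable setT (fun w => conjugate (f^~ w) (xs w + v w))] &
    is_condexp P G (fun w => conjugate (f^~ w) (xs w + v w)) (EFin \o Y) /\
    {ae P, forall w, conjugate (h^~ w) (xs w) = (Y w)%:E}.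
Proof.
move=> Lxs [phi0 [v Lv hv]].
set r := fine (tilde_phi P G f xs (cst 0%R)).
have phir : tilde_phi P G f xs (cst 0%R) = r%:E by rewrite fineK.
have orth z M := @subgradient_orthogonal xs v z M Lv phi0 hv.
have mxs := L0_vmeasurable hG Lxs.1.
have mv := L0_vmeasurable hF Lv.1.
have [_ iv] := (Lp1P P hF v).1 Lv.
have Ev0 : is_condexp_vec P G v (cst 0).
  move=> j; rewrite (_ : (fun w : T => ((cst 0 : T -> 'rV[R]_n) w 0 j)%:E) = cst 0%E); last first.
    by apply/funext => w; rewrite mxE.
  apply: integrable_is_condexp => //; first exact: iv.
    by apply/(sub_measurableP hG); exact: measurable_cst.
  move=> A GA; have mA := GT GA.
  have iA : P.-integrable A (EFin \o (fun w => v w 0 j)).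
    exact: integrableS (iv j).
  rewrite (EFin_Rintegral mA iA) [RHS]integral0_eq//; congr EFin.
  (* The unit vector [j] carried by [A] tests the [j]-th coordinate of [v] on [A]. *)
  pose z w : 'rV[R]_n := if w \in A then delta_mx 0 j else 0.
  have zv : \int[P]_(w in A) v w 0 j = \int[P]_w dot (z w) (v w).
    rewrite Rintegral_mkcond; apply: eq_Rintegral => w _; rewrite patchE /z.
    case: ifP => _; last by rewrite dot0l.
    rewrite /dot (bigD1 j)//= mxE !eqxx mul1r big1 ?addr0// => i ij.
    by rewrite mxE (negbTE ij) andbF mul0r.
  rewrite zv; apply: (orth z 1).
    apply/(L0P hG)/vmeasurable_if; first by rewrite (sub_measurableE hG).
      exact: vmeasurable_cst.
    exact: vmeasurable_cst.
  move=> w; rewrite /z; case: ifP => _; last by rewrite normr0.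
  apply/rV_norm_ler => // i; rewrite mxE; case: (_ && _); rewrite ?normr1 ?normr0//.
pose u w := xs w + v w.
have Lu : Lp P F 1%E u by apply: Lp1D => //; exact: Lp1_sub.
have mu := L0_vmeasurable hF Lu.1.
have [ig gc] : P.-integrable setT (fun w => conjugate (f^~ w) (u w)) /\
    (\int[P]_w conjugate (f^~ w) (u w) <= (- r)%:E)%E.
  have icl := conjugate_interchange (c := - r) nf Lv0 Efv0 (L0_vmeasurable hG Lx0) x0M fx0 Lu.
  apply: icl => y M my yM ify.
  have idot a : Lp P F 1%E a -> P.-integrable setT (EFin \o (fun w => dot (y w) (a w))).
    by move=> La; apply: (dot_integrable hF _ my _ La) => // w _; exact: yM.
  have Ly : Lp P F +oo%E y.
    apply: (ae_bounded_Lpoo (M := M)) => //; first exact: vmeasurable_L0.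
    exact: aeW.
  have i1 := idot _ (Lp1_sub Lxs); have i2 := idot _ Lv.
  have := le_trans (hv y Ly) (tilde_phi_le Lxs my ify i1).
  rewrite phir unlock (EFin_Rintegral measurableT i2) -EFinD lee_fin opprK.
  have -> : \int[P]_w (fine (f (y w) w) - dot (y w) (u w)) =
      \int[P]_w (fine (f (y w) w) - dot (y w) (xs w)) - \int[P]_w dot (y w) (v w).
    rewrite -RintegralB//; last first.
      exact: (integrableB measurableT (integrable_fine measurableT ify) i1).
    by apply: eq_Rintegral => w _; rewrite /u dotDr opprD addrA.
  by lra.
pose g w := conjugate (f^~ w) (u w).
have [Y [sY iY YE]] := condexp_exists hG (integrable_fine measurableT ig).
have gY A : G A -> (\int[P]_(w in A) g w = \int[P]_(w in A) (Y w)%:E)%E.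
  move=> GA; have mA := GT GA.
  by rewrite -YE// (integral_fine mA (integrableS measurableT mA _ ig))// EFin_Rintegral//;
    exact: (integrable_fine mA (integrableS measurableT mA _ ig)).
have gfin := ae_fineK measurableT ig.
have hY : {ae P, forall w p, ((dot p (xs w) + - Y w)%:E <= h p w)%E}.
  apply: (condexp_integrand_ge (rho := cst 0) Lxs.1).
  - apply/(sub_measurableP hG)/measurable_funN.
    exact/(sub_measurableP hG).
  - by apply/(sub_measurableP hG); exact: measurable_cst.
  move=> y A N Ly yN GA bA.
  have mA := GT GA; have my := L0_vmeasurable hG Ly.
  have idot a : Lp P F 1%E a -> P.-integrable A (EFin \o (fun w => dot (y w) (a w))).
    by move=> La; apply: (dot_integrable hF _ my _ La) => // w _; exact: yN.
  have i1 := idot _ (Lp1_sub Lxs); have i2 := idot _ Lv; have iu := idot _ Lu.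
  have igA := integrable_fine mA (integrableS measurableT mA (@subsetT _ _) ig).
  have iYA := integrableS measurableT mA (@subsetT _ _) iY.
  (* Since [y] is measurable for [G] and E^G v = 0, the slope [u] can be exchanged for [xs] under
     the integral. *)
  have v0A : \int[P]_(w in A) dot (y w) (v w) = 0.
    rewrite (condexp_vec_dot hG Lv Lp1_0 Ev0 Ly GA (fun w _ => yN w)).
    by rewrite /Rintegral integral0_eq// => w _; rewrite dotC dot0l.
  have i3 := integrableB mA iu igA.
  have -> : (\int[P]_(w in A) (dot (y w) (xs w) + - Y w)%:E)%E =
      (\int[P]_(w in A) (dot (y w) (u w) - fine (g w))%:E)%E.
    rewrite (EFin_Rintegral mA i3) EFin_Rintegral//; last exact: (integrableB mA i1 iYA).
    congr EFin; rewrite !RintegralB//; congr (_ - _).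
      rewrite -[LHS]addr0 -v0A -RintegralD//.
      by apply: eq_Rintegral => w _; rewrite dotDr.
    by apply: EFin_inj; rewrite -!EFin_Rintegral// YE.
  apply: (ae_le_integral mA (measurable_int _ i3)).
    by apply: measurable_funTS; exact: measurable_normal_integrand.
  apply: filterS gfin => w /(_ Logic.I) gw _.
  by apply: (@conjugate_le _ _ (f^~ w)); rewrite {1}gw.
have mhs : measurable_fun setT (fun w => conjugate (h^~ w) (xs w)).
  apply: (sub_measurable_measurable hG).
  by apply: (measurable_conjugate (normal_integrand_sub hG fh.1)); exact/(L0P hG)/Lxs.1.
have hsY : {ae P, forall w, (conjugate (h^~ w) (xs w) <= (Y w)%:E)%E}.
  by apply: filterS hY => w hw; apply: le_conjugate => p; exact: hw.
have minim e : 0 < e -> exists2 l : T -> R, P.-integrable setT (EFin \o l) &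
    {ae P, forall w, ((l w)%:E <= conjugate (h^~ w) (xs w))%E} /\
    - r - e <= \int[P]_w l w.
  move=> e0; have [x [M [Lx xM] [ifx xe]]] := tilde_phi_minimizer Lxs phir e0.
  have mx := L0_vmeasurable hG Lx.
  have cx := bounded_is_condexp Lx xM.
  have ihx := condexp_integrable sub_setT cx ifx.
  have idot : P.-integrable setT (EFin \o (fun w => dot (x w) (xs w))).
    by apply: (dot_integrable hG _ mx _ Lxs) => // w _; exact: xM.
  have ifhx := integrable_fine measurableT ihx.
  exists (fun w => dot (x w) (xs w) - fine (h (x w) w)).
    exact: (integrableB measurableT idot ifhx).
  split.
    have := ae_fineK measurableT ihx; apply: filterS => w /(_ Logic.I) hx.
    have := @fenchel _ _ (h^~ w) (x w) (xs w); rewrite hx => /(_ isT).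
    by rewrite -leeBlDl.
  have [_ _ _ /(_ setT sub_setT)] := cx.
  rewrite (integral_fine measurableT ifx) (integral_fine measurableT ihx) => -[fhx].
  move: xe; rewrite !RintegralB//; last exact: integrable_fine.
  by rewrite fhx; lra.
(* The conjugate of [h] at [xs] lies between an integrable minorant given by a near minimizer and
   the integrable [Y]. *)
have ihs : P.-integrable setT (fun w => conjugate (h^~ w) (xs w)).
  have [l il [ll _]] := minim 1 ltr01.
  have := integrableD measurableT (integrable_abse il) (integrable_abse iY).
  apply: ae_le_integrable => //.
  apply: filterS2 ll hsY => w; case: (conjugate _ _) => [s| |]//=.
  rewrite !lee_fin => ls sY' _; rewrite [leRHS]ger0_norm ?addr_ge0//.
  rewrite ler_norml; have := ler_norm (Y w); have := ler_norm (- l w).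
  rewrite normrN; have := normr_ge0 (Y w); have := normr_ge0 (l w).
  by move=> ? ? ? ?; apply/andP; split; lra.
have hsfin := ae_fineK measurableT ihs.
have ifhs := integrable_fine measurableT ihs.
have Yle : \int[P]_w (Y w - fine (conjugate (h^~ w) (xs w))) <= 0.
  apply/ler_addgt0Pr => e e0; rewrite add0r RintegralB//.
  have [l il [ll le]] := minim e e0.
  have : \int[P]_w l w <= \int[P]_w fine (conjugate (h^~ w) (xs w)).
    apply: ae_le_Rintegral => //.
    by apply: filterS2 ll hsfin => w lw hw _; rewrite -lee_fin -hw.
  have : \int[P]_w Y w <= - r.
    by rewrite -lee_fin -(EFin_Rintegral measurableT iY) -gY//; exact: sub_setT.
  by lra.
exists v, Y; first by split.
split.
  by apply: integrable_is_condexp => // B mB; rewrite comp_preimage; apply: sY;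
    rewrite -[X in measurable X]setTI; exact: EFin_measurable.
have iD := integrableB measurableT iY ifhs.
have D0 : {ae P, forall w, setT w -> 0 <= Y w - fine (conjugate (h^~ w) (xs w))}.
  by apply: filterS2 hsY hsfin => w hw hf _; rewrite subr_ge0 -lee_fin -hf.
have := ge0_Rintegral_le0 measurableT iD D0 Yle.
apply: filterS2 hsfin => w hf /(_ Logic.I)/eqP.
by rewrite subr_eq0 => /eqP ->; exact: hf.
Qed.

(** * Subgradients at a possibly unbounded point *)

Section AtPoint.
Variable x : T -> 'rV[R]_n.
Hypothesis Lx : L0 G x.
Hypothesis fx : (Eint P f x < +oo)%E.

Let mx : vmeasurable x. Proof. exact: (L0_vmeasurable hG Lx). Qed.

Lemma integrand_condexp_at : is_condexp P G (fun w => f (x w) w) (fun w => h (x w) w).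
Proof. by apply: fh.2 => //; left; exact: Eext_lty fx. Qed.

Lemma integrand_integrable_on A (N : R) : G A -> (forall w, A w -> `|x w| <= N) ->
  P.-integrable A (fun w => f (x w) w) /\ P.-integrable A (fun w => h (x w) w).
Proof.
move=> GA xN; have mA := GT GA.
have ifA : P.-integrable A (fun w => f (x w) w).
  apply: (bounded_integrand_integrable nf Lv0 Efv0 mA mx xN).
  exact: integrableS (Eext_lty fx).
by split=> //; exact: condexp_integrable integrand_condexp_at ifA.
Qed.

Let GxN (N : nat) : G [set w | `|x w| <= N%:R].
Proof.
rewrite -(sub_measurableE hG).
rewrite (_ : [set w | _] = (fun w => `|x w|) @^-1` `]-oo, N%:R]%classic).
  rewrite -[X in measurable X]setTI.
  exact: (measurable_rV_norm ((L0P hG x).1 Lx)).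
by apply/seteqP; split=> w; rewrite /= in_itv.
Qed.

(** Countably many sets of the form |x| <= N cover the space, so almost sure statements may be
    proved where x is bounded. *)
Lemma ae_bounded_exhaust (Q : T -> Prop) :
  (forall N : nat, {ae P, forall w, `|x w| <= N%:R -> Q w}) ->
  {ae P, forall w, Q w}.
Proof.
move=> /ae_foralln; apply: filterS => w QN.
by apply: (QN (Num.truncn `|x w|).+1); exact/ltW/truncnS_gt.
Qed.

Lemma ae_fin_num_at :
  {ae P, forall w, f (x w) w \is a fin_num /\ h (x w) w \is a fin_num}.
Proof.
apply: ae_bounded_exhaust => N.
have [i1 i2] := integrand_integrable_on (GxN N) (fun w => id).
have mA := GT (GxN N).
apply: filterS2 (integrable_ae mA i1) (integrable_ae mA i2) => w f1 f2 xN.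
by split; [exact: f1|exact: f2].
Qed.

Lemma condexp_vec_Lp v u : Lp P F 1%E v -> is_condexp_vec P G v u -> Lp P G 1%E u.
Proof.
move=> Lv vu; have [_ iv] := (Lp1P P hF v).1 Lv.
apply/(Lp1P P hG); split=> j; last first.
  exact: condexp_integrable sub_setT (vu j) (iv j).
have [_ _ su _] := vu j; apply/(sub_measurableP hG).
by apply/measurable_EFinP; exact/(sub_measurableP hG).
Qed.

(** On a set of [G] where x and y are bounded, the pairing with y - x is continuous for the L^1
    norm, so the integrated subgradient inequality passes from conditional expectations of
    selections to their limit [u]. *)
Lemma closure_subdiff u :
  L1_closure P G [set u | exists2 v, Lp_sel P F 1%E (fun w => subdiff (f^~ w) (x w)) v
    & is_condexp_vec P G v u] u ->
  {ae P, forall w, subdiff (h^~ w) (x w) (u w)}.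
Proof.
move=> [Lu cl].
have mhx : sub_measurable G (fun w => h (x w) w) by have [] := integrand_condexp_at.
pose b w := fine (h (x w) w) - dot (x w) (u w).
have sb : sub_measurable G b.
  apply/(sub_measurableP hG)/measurable_funB.
    by apply: measurableT_comp => //; exact/(sub_measurableP hG).
  by apply: measurable_dot; [exact: ((L0P hG x).1 Lx)|exact: ((L0P hG u).1 Lu.1)].
have sx : sub_measurable G (fun w => `|x w|).
  by apply/(sub_measurableP hG)/measurable_rV_norm/(L0P hG).
have key : {ae P, forall w p, ((dot p (u w) + b w)%:E <= h p w)%E}.
  apply: (condexp_integrand_ge Lu.1 sb sx) => y A N Ly yN GA bA.
  have mA := GT GA; have my := L0_vmeasurable hG Ly.
  have xN w : A w -> `|x w| <= N by move=> /bA[].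
  have [ifx ihx] := integrand_integrable_on GA xN.
  pose z w := y w - x w.
  have Lz : L0 G z by apply/(L0P hG)/vmeasurableB; exact/(L0P hG).
  have mz := L0_vmeasurable hG Lz.
  have zN w : A w -> `|z w| <= N + N.
    move=> Aw; apply: le_trans (ler_normB _ _) _.
    by apply: lerD => //; exact: xN.
  have idot a : Lp P F 1%E a -> P.-integrable A (EFin \o (fun w => dot (z w) (a w))).
    exact: (dot_integrable hF mA mz zN).
  have ifhx := integrable_fine mA ihx; have iffx := integrable_fine mA ifx.
  have [_ _ _ fhE] := integrand_condexp_at.
  have {}fhE : \int[P]_(w in A) fine (f (x w) w) = \int[P]_(w in A) fine (h (x w) w).
    by apply: EFin_inj; rewrite -!integral_fine// fhE.
  have iu := idot _ (Lp1_sub Lu).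
  have mfy : measurable_fun A (fun w => f (y w) w).
    by apply: measurable_funTS; exact: measurable_normal_integrand.
  rewrite (_ : (\int[P]_(w in A) _)%E =
      (\int[P]_(w in A) (dot (z w) (u w) + fine (h (x w) w)))%:E); last first.
    rewrite -EFin_Rintegral//; last exact: (integrableD mA iu ifhx).
    by apply: eq_integral => w _; rewrite /z /b dotBl; congr EFin; ring.
  apply/lee_addgt0Pr => e e0.
  (* [C] is the Lipschitz constant of the pairing with [z]; the absolute value and the added 1 make
     the divisor positive whatever the sign of [N]. *)
  pose C := n%:R * (N + N).
  have e'0 : 0 < e / (`|C| + 1) by rewrite divr_gt0// ltr_wpDl.
  have [u' [v [Lv fv] vu'] uu'] := cl _ e'0.
  have Lu' := condexp_vec_Lp Lv vu'.
  have iu' := idot _ (Lp1_sub Lu'); have iv := idot _ Lv.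
  have Lw : Lp P G 1%E (fun w => u w - u' w).
    apply/(Lp1P P hG); have [_ iuj] := (Lp1P P hG u).1 Lu.
    have [_ iu'j] := (Lp1P P hG u').1 Lu'; split=> [|j].
      by apply/(L0P hG)/vmeasurableB; apply/(L0P hG); [case: Lu|case: Lu'].
    have := integrableB measurableT (iuj j) (iu'j j).
    by apply: eq_integrable => // w _ /=; rewrite !mxE.
  have inw := norm_integrable hG Lw.
  have iw := idot _ (Lp1_sub Lw).
  have small : \int[P]_(w in A) dot (z w) (u w) - \int[P]_(w in A) dot (z w) (u' w) <= e.
    rewrite -RintegralB//.
    have -> : \int[P]_(w in A) (dot (z w) (u w) - dot (z w) (u' w)) =
        \int[P]_(w in A) dot (z w) (u w - u' w).
      by apply: eq_Rintegral => w _; rewrite dotBr.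
    have inwA := integrableS measurableT mA (@subsetT _ A) inw.
    apply: (@le_trans _ _ (\int[P]_(w in A) (`|C| * `|u w - u' w|))).
      apply: le_Rintegral => //; first exact: (integrableZl mA _ inwA).
      move=> w Aw; apply: le_trans (ler_norm _) _; apply: le_trans (ler_norm_dot _ _) _.
      rewrite mulrA ler_wpM2r//; apply: le_trans (ler_norm _).
      by rewrite ler_wpM2l// zN.
    rewrite RintegralZl//.
    have : \int[P]_(w in A) `|u w - u' w| <= \int[P]_w `|u w - u' w|.
      rewrite -lee_fin -!EFin_Rintegral//.
      apply: ge0_subset_integral => //; first exact: measurable_int inw.
    move: uu'; rewrite Lnorm1; under eq_integral do rewrite /= normr_id.
    rewrite (EFin_Rintegral measurableT inw) lte_fin ltr_pdivlMr ?ltr_wpDl// => uu' le1.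
    have := Rintegral_ge0 P (D := A) (fun w _ => normr_ge0 (u w - u' w)).
    by have := normr_ge0 C; nra.
  rewrite RintegralD// -fhE.
  have vE := condexp_vec_dot hG Lv Lu' vu' Lz GA zN.
  have step : ((\int[P]_(w in A) (dot (z w) (v w) + fine (f (x w) w)))%:E <=
      \int[P]_(w in A) f (y w) w)%E.
    have isum := integrableD mA iv iffx.
    rewrite -EFin_Rintegral//; apply: (ae_le_integral mA (measurable_int _ isum)) => //.
    apply: filterS fv => w /subdiffP[_ sd] _; apply: le_trans (sd (y w)).
    by rewrite lee_fin /= /z dotBl; lra.
  apply: le_trans (leeD step (lexx e%:E)).
  by rewrite -EFinD lee_fin RintegralD// vE; lra.
apply: filterS2 key ae_fin_num_at => w hw [_ hx].
by apply/subdiffP; split.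
Qed.

(** The field [xs] is exactly the conditional expectation of the selection [xs + v], so it belongs
    to the set before any closure is taken. *)
Lemma subdiff_closure xs :
  Lp_sel P G 1%E (fun w => subdiff (h^~ w) (x w)) xs ->
  subdifferentiable0 P (tilde_phi P G f xs) ->
  L1_closure P G [set u | exists2 v, Lp_sel P F 1%E (fun w => subdiff (f^~ w) (x w)) v
    & is_condexp_vec P G v u] xs.
Proof.
move=> [Lxs hxs] /(conjugate_condexp Lxs)[v [Y [Lv v0E ig] [gY hY]]].
pose u w := xs w + v w.
have Lu : Lp P F 1%E u by apply: Lp1D => //; exact: Lp1_sub.
split=> // e e0; exists xs; last first.
  rewrite Lnorm1; under eq_integral do rewrite subrr normr0 abse0.
  by rewrite integral0 lte_fin.
exists u; last first.
  have [_ iv] := (Lp1P P hF v).1 Lv; have [Lxs0 ixs] := (Lp1P P hG xs).1 Lxs.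
  move=> j; apply: integrable_is_condexp => //.
  - have := integrableD measurableT (ixs j) (iv j).
    by apply: eq_integrable => // w _ /=; rewrite mxE.
  - apply/(sub_measurableP hG)/measurable_EFinP.
    exact: ((L0P hG xs).1 Lxs0 j).
  - move=> A GA; have mA := GT GA.
    have ixA := integrableS measurableT mA (@subsetT _ A) (ixs j).
    have ivA := integrableS measurableT mA (@subsetT _ A) (iv j).
    under eq_integral do rewrite mxE EFinD.
    rewrite integralD//; have [_ _ _ /(_ A GA) ->] := v0E j.
    by rewrite [X in (_ + X)%E]integral0_eq ?adde0// => w _; rewrite mxE.
split=> //; apply: ae_bounded_exhaust => N.
pose A := [set w | `|x w| <= N%:R]; have GA : G A by exact: GxN.
have mA := GT GA.
have [ifx ihx] := integrand_integrable_on GA (fun w => id).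
have idot a : Lp P F 1%E a -> P.-integrable A (EFin \o (fun w => dot (x w) (a w))).
  exact: (dot_integrable hF mA mx (fun w => id)).
have i1 := idot _ (Lp1_sub Lxs); have i2 := idot _ Lv; have iu := idot _ Lu.
have igA := integrableS measurableT mA (@subsetT _ A) ig.
have iYA := condexp_integrable GA gY igA.
have ifx' := integrable_fine mA ifx; have ihx' := integrable_fine mA ihx.
have igA' := integrable_fine mA igA.
pose D w := fine (f (x w) w) + fine (conjugate (f^~ w) (u w)) - dot (x w) (u w).
have iD : P.-integrable A (EFin \o D).
  exact: (integrableB mA (integrableD mA ifx' igA') iu).
have D0 : {ae P, forall w, A w -> 0 <= D w}.
  apply: filterS2 (ae_fineK mA ifx) (ae_fineK mA igA) => w fw gw Aw.
  have := @fenchel _ _ (f^~ w) (x w) (u w); rewrite (fw Aw) => /(_ isT).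
  by rewrite /u (gw Aw) -EFinD lee_fin subr_ge0.
have DE : \int[P]_(w in A) D w <= 0.
  (* Conditioning each of the three terms turns the Fenchel gap of f at (x, u) into that of [h] at
     (x, xs), which is at most 0 as [xs] is a subgradient. *)
  have -> : \int[P]_(w in A) D w =
      \int[P]_(w in A) fine (f (x w) w) +
      \int[P]_(w in A) fine (conjugate (f^~ w) (u w)) - \int[P]_(w in A) dot (x w) (u w).
    rewrite RintegralB//; last exact: (integrableD mA ifx' igA').
    by rewrite RintegralD.
  have -> : \int[P]_(w in A) fine (f (x w) w) = \int[P]_(w in A) fine (h (x w) w).
    have [_ _ _ fhE] := integrand_condexp_at.
    by apply: EFin_inj; rewrite -!integral_fine// fhE.
  have -> : \int[P]_(w in A) fine (conjugate (f^~ w) (u w)) = \int[P]_(w in A) Y w.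
    have [_ _ _ gE] := gY.
    by apply: EFin_inj; rewrite -integral_fine// gE// EFin_Rintegral.
  have -> : \int[P]_(w in A) dot (x w) (u w) = \int[P]_(w in A) dot (x w) (xs w).
    have v00 : \int[P]_(w in A) dot (x w) (v w) = 0.
      rewrite (condexp_vec_dot hG Lv Lp1_0 v0E Lx GA (fun w => id)).
      by rewrite /Rintegral integral0_eq// => w _; rewrite dotC dot0l.
    rewrite -[RHS]addr0 -v00 -RintegralD//.
    by apply: eq_Rintegral => w _; rewrite dotDr.
  rewrite -RintegralD// subr_le0; apply: ae_le_Rintegral => //.
    exact: (integrableD mA ihx' iYA).
  apply: filterS2 hxs hY => w sd hYw Aw; have [hx _] := sd.
  move: sd => /(subdiff_conjugateP _ hx); rewrite hYw lee_fin.
  by lra.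
apply: filterS3 (ge0_Rintegral_le0 mA iD D0 DE) (ae_fineK mA ifx)
  (ae_fineK mA igA) => w Dw fw gw Aw.
have fxw : f (x w) w \is a fin_num by rewrite (fw Aw).
apply/(subdiff_conjugateP _ fxw); rewrite (gw Aw) lee_fin.
by have := Dw Aw; rewrite /D /u; lra.
Qed.

End AtPoint.

End ConditionalIntegrand.

Theorem theorem10 (R : realType) (d : measure_display) (T : measurableType d)
    (P : probability T R) (n : nat) (G : set_system T)
    (f EGf : 'rV[R]_n -> T -> \bar R)
    (hG : is_sub_sigma_algebra G)
    (fnormal : normal_integrand (@measurable d T) f)
    (fconvex : forall w, econvex (f^~ w))
    (domEf : exists2 x : T -> 'rV[R]_n, Lp P G +oo%E x &
       (Eint P f x < +oo)%E)
    (domEfs : exists2 v : T -> 'rV[R]_n, Lp P (@measurable d T) 1%E v &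
       (Eint P (fun y w => conjugate (f^~ w) y) v < +oo)%E)
    (hEGf : is_condexp_integrand P G f EGf) :
  (forall xs : T -> 'rV[R]_n, Lp P G 1%E xs ->
     subdifferentiable0 P (tilde_phi P G f xs) ->
     exists v : T -> 'rV[R]_n,
       [/\ Lp P (@measurable d T) 1%E v,
           is_condexp_vec P G v (cst 0) &
           exists2 Y : T -> \bar R,
             is_condexp P G (fun w => conjugate (f^~ w) (xs w + v w)) Y &
             {ae P, forall w, conjugate (EGf^~ w) (xs w) = Y w}])
  /\
  (forall x : T -> 'rV[R]_n, L0 G x -> (Eint P f x < +oo)%E ->
     (forall xs : T -> 'rV[R]_n,
        Lp_sel P G 1%E (fun w => subdiff (EGf^~ w) (x w)) xs ->
        subdifferentiable0 P (tilde_phi P G f xs)) ->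
     Lp_sel P (@measurable d T) 1%E (fun w => subdiff (f^~ w) (x w)) !=set0 ->
     forall C : T -> set 'rV[R]_n,
       is_condexp_set P G (fun w => subdiff (f^~ w) (x w)) C ->
       {ae P, forall w, subdiff (EGf^~ w) (x w) = C w}).
Proof.
have [x1 Lx1 Efx1] := domEf.
have [v0 Lv0 Efv0] := domEfs.
have [x0 [M0 [Lx0 x0M] xx0]] := Lpoo_bounded hG Lx1.
have mx0 := L0_vmeasurable hG Lx0.
have fx0 : P.-integrable setT (fun w => f (x0 w) w).
  apply: (bounded_integrand_integrable fnormal Lv0 Efv0 measurableT mx0 (fun w _ => x0M w)).
  apply: (ae_eq_integrable measurableT _ _ (Eext_lty Efx1)).
    exact/measurable_funepos/measurable_normal_integrand.
  by apply: filterS xx0 => w xw _; rewrite !funeposE xw.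
have conj_condexp := conjugate_condexp hG fnormal hEGf Lv0 Efv0 Lx0 x0M fx0.
split=> [xs Lxs sub0|x Lx Efx sub0 [v [Lv fv]] C [cC mC CE]].
  have [v [Y [Lv v0E _] [gY hY]]] := conj_condexp xs Lxs sub0.
  by exists v; split=> //; exists (EFin \o Y).
pose D w := subdiff (EGf^~ w) (x w).
have cD w : closed (D w) by exact: closed_subdiff.
have mD : set_measurable G D.
  move=> O oO; rewrite -(sub_measurableE hG).
  have nh := normal_integrand_sub hG hEGf.1.
  exact: (subdiff_set_measurable nh ((L0P hG x).1 Lx) oO).
have CD : Lp_sel P G 1%E C `<=` Lp_sel P G 1%E D.
  move=> u; rewrite CE => Cu; split; first by case: Cu.
  exact: (closure_subdiff hG fnormal hEGf Lv0 Efv0 Lx Efx Cu).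
have DC : Lp_sel P G 1%E D `<=` Lp_sel P G 1%E C.
  move=> u Du; rewrite CE.
  exact: (subdiff_closure hG fnormal hEGf Lv0 Efv0 Lx0 x0M fx0 Lx Efx Du (sub0 u Du)).
(* The assumed integrable selection of the right-hand side, once conditioned, is a common integrable
   selection of [C] and [D], the one that [selections_subset] needs for pasting. *)
have [u Lu vu] := condexp_vec_exists hG Lv.
have Cu : Lp_sel P G 1%E C u.
  rewrite CE; split=> // e e0; exists u; first by exists v.
  rewrite Lnorm1; under eq_integral do rewrite subrr normr0 abse0.
  by rewrite integral0 lte_fin.
have := selections_subset hG cC cD mC mD Cu CD.
apply: filterS2 (selections_subset hG cD cC mD mC (CD _ Cu) DC) => w DCw CDw.
by apply/seteqP; split.
Qed.
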